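(* There is an absolute constant $c$ such that for all positive integers $r$ and $\ell$ the following holds: if $H$ is a graph that is the disjoint union of $r$ cycles, each of length at most $\ell$, then \[ f(H) \le c\,|V(H)|\log(r+1) + c\, r\log r\log \ell. \]
   Context: All graphs are finite and simple; all logarithms are base 2. A graph $H$ is a minor of $G$ if $H$ can be obtained from a subgraph of $G$ by contracting edges. For a planar graph $H$, $f(H)$ denotes the smallest integer $n$ such that every graph that does not contain $H$ as a minor has treewidth at most $n$ (this exists by the Grid Minor Theorem of Robertson and Seymour). *)

(* Defs.v *)
From mathcomp Require Import all_boot.
From Stdlib Require Import Reals.

Set Implicit Arguments.
Unset Strict Implicit.
Unset Printing Implicit Defensive.

Definition simple_graph (V : finType) (E : rel V) : Prop :=
  symmetric E /\ irreflexive E.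

Definition restrict_rel (V : finType) (A : {set V}) (E : rel V) : rel V :=
  fun u v => [&& u \in A, v \in A & E u v].

Definition connected_in (V : finType) (E : rel V) (A : {set V}) : Prop :=
  forall u v, u \in A -> v \in A -> connect (restrict_rel A E) u v.

(* H is a minor of G: existence of a minor model (branch sets), the standard
   formulation of "obtainable from a subgraph of G by contracting edges". *)
Definition is_minor (VH : finType) (EH : rel VH) (VG : finType) (EG : rel VG)
  : Prop :=
  exists phi : VH -> {set VG},
    [/\ forall x, phi x != set0,
        forall x, connected_in EG (phi x),
        forall x y, x != y -> [disjoint phi x & phi y]
      & forall x y, EH x y ->
          exists u v, [/\ u \in phi x, v \in phi y & EG u v]].

Definition is_tree (T : finType) (ET : rel T) : Prop :=
  [/\ simple_graph ET,
      forall s t : T, connect ET s t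
    & forall s : seq T, 3 <= size s -> uniq s -> ~~ cycle ET s].

Definition tree_decomposition_width_le (V : finType) (E : rel V) (k : nat)
  : Prop :=
  exists (T : finType) (ET : rel T) (B : T -> {set V}),
    [/\ is_tree ET,
        forall v : V, exists t, v \in B t,
        forall u v, E u v -> exists t, u \in B t /\ v \in B t,
        forall v : V, connected_in ET [set t | v \in B t]
      & forall t, #|B t| <= k.+1].

Definition treewidth_le (V : finType) (E : rel V) (k : nat) : Prop :=
  tree_decomposition_width_le E k.

(* n has the defining property of f(H): every finite simple graph with no
   H minor has treewidth at most n.  f(H) is the least such n, so
   "f(H) <= X" is equivalent to "some n with f_property H n has n <= X". *)
Definition f_property (VH : finType) (EH : rel VH) (n : nat) : Prop :=
  forall (VG : finType) (EG : rel VG),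
    simple_graph EG -> ~ is_minor EH EG -> treewidth_le EG n.

Definition cycles_vertex (r : nat) (len : 'I_r -> nat) : finType :=
  {i : 'I_r & 'I_(len i)}.

Definition cycles_edge (r : nat) (len : 'I_r -> nat)
  : rel (cycles_vertex len) :=
  fun x y =>
    (tag x == tag y) &&
    ((val (tagged y) == (val (tagged x)).+1 %% len (tag x)) ||
     (val (tagged x) == (val (tagged y)).+1 %% len (tag y))).

Definition log2 (x : R) : R := (ln x / ln 2)%R.

(* Main.v *)
(* After deleting few vertices every circuit is shorter than |V(H)|, and the depth-first
   forest then has bags consisting of the last |V(H)| ancestors.  To find the deleted set,
   look for the longest cycle of H first, of length l.  If there is a circuit of length
   in [l, 2l), take it and delete it.  Otherwise every circuit is short (< l) or long (>= 2l),
   and an exchange argument over F_2 shows that a long circuit is never a sum of short ones.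
   Take a maximal subgraph F (the "frame") with all degrees 0, 2 or 3 and without short
   circuits.  By Simonovits' argument F contains r disjoint circuits unless it becomes a
   forest after deleting O(r log r) edges.  In the latter case maximality of F makes every
   ear of F that avoids the degree-3 vertices close up to a short circuit inside F; deleting
   the degree-3 vertices, the vertices at which a long circuit hangs off F by a single
   vertex, and O(r log r) vertices at which no ear can jump over makes every remaining
   circuit a sum of short ones.  The resulting bound is 3 |V(H)| + O(r log r). *)
Require Import Defs.
From HB Require Import structures.
From mathcomp Require Import all_boot.
From mathcomp Require Import zify.

Set Implicit Arguments.
Unset Strict Implicit.
Unset Printing Implicit Defensive.

(** The gap [l, 2l) is chosen so that short circuits combine: two of them that share an edge have a
    sum and a union of fewer than 2l edges, and every circuit inside these is short again. Short
    circuits therefore behave like filled-in discs, and a long circuit like a nontrivial homology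
    class; most arguments about the frame end by exhibiting a long circuit as a sum of short ones.
    Edges are vectors over F_2 so that such sums need no cyclic orders. The longest cycle comes
    first because the circuits packed at the end have at least its length and so can stand in for
    every cycle of H that remains. Degrees in the frame stop at 3 because then each vertex of a
    circuit sends at most one edge off it, and deleting a circuit with few degree-3 vertices
    destroys few independent circuits. The coefficient 3 of |V(H)| is 2 for the deleted circuits of
    length below 2l and 1 for the depth of the bags. As r is at most |V(H)|, the O(r log r) part is
    absorbed into |V(H)| log(r+1). *)

(** * Symmetric difference as addition of sets over F_2 *)

Section SymDiff.
Variable T : finType.
Implicit Types A B C : {set T}.

Definition symd A B := [set x | (x \in A) (+) (x \in B)].

Lemma in_symd x A B : (x \in symd A B) = (x \in A) (+) (x \in B).
Proof. by rewrite inE. Qed.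

Lemma symdA : associative symd.
Proof. by move=> A B C; apply/setP=> x; rewrite !in_symd addbA. Qed.
Lemma symdC : commutative symd.
Proof. by move=> A B; apply/setP=> x; rewrite !in_symd addbC. Qed.
Lemma sym0d : left_id set0 symd.
Proof. by move=> A; apply/setP=> x; rewrite !in_symd in_set0. Qed.
Lemma symd0 : right_id set0 symd.
Proof. by move=> A; rewrite symdC sym0d. Qed.
Lemma symdd A : symd A A = set0.
Proof. by apply/setP=> x; rewrite !in_symd addbb inE. Qed.

HB.instance Definition _ := Monoid.isComLaw.Build {set T} set0 symd symdA symdC sym0d.

Lemma symdK A B : symd A (symd A B) = B.
Proof. by rewrite symdA symdd sym0d. Qed.

Lemma symd_eq0 A B : symd A B = set0 -> A = B.
Proof. by move=> h; rewrite -(symd0 A) -h symdK. Qed.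

Lemma symd_sub A B C : A \subset C -> B \subset C -> symd A B \subset C.
Proof.
move=> /subsetP hA /subsetP hB; apply/subsetP=> x; rewrite in_symd.
by case: (boolP (x \in A)) => [/hA //|_]; case: (boolP (x \in B)) => [/hB|].
Qed.

Lemma symd_subU A B : symd A B \subset A :|: B.
Proof. by apply: symd_sub; [apply: subsetUl | apply: subsetUr]. Qed.

Lemma symd_setD A B : A \subset B -> symd B A = B :\: A.
Proof.
move=> /subsetP h; apply/setP=> x; rewrite in_symd inE.
by case: (boolP (x \in A)) => [/h -> //|_]; rewrite addbF.
Qed.

Lemma symd_disj A B : [disjoint A & B] -> symd A B = A :|: B.
Proof.
move=> h; apply/setP=> x; rewrite in_symd inE.
by case: (boolP (x \in A)) => // /(disjointFr h) ->.
Qed.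

Lemma symd_ID A B : symd (A :&: B) (A :\: B) = A.
Proof. by apply/setP=> x; rewrite in_symd !inE; case: (x \in A); case: (x \in B). Qed.

Lemma card_symd A B : #|symd A B| + (#|A :&: B|).*2 = #|A| + #|B|.
Proof.
have -> : symd A B = (A :\: B) :|: (B :\: A).
  by apply/setP=> x; rewrite in_symd !inE; case: (x \in A); case: (x \in B).
rewrite -(cardsID B A) -(cardsID A B) cardsU.
have -> : (A :\: B) :&: (B :\: A) = set0.
  by apply/setP=> x; rewrite !inE; case: (x \in A); case: (x \in B).
rewrite cards0 (setIC B A); lia.
Qed.

Lemma odd_symd A B : odd #|symd A B| = odd #|A| (+) odd #|B|.
Proof. by rewrite -oddD -card_symd oddD odd_double addbF. Qed.

Lemma card_symd_le A B : #|symd A B| <= #|A| + #|B|.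
Proof. by rewrite -card_symd leq_addr. Qed.

Lemma bigsymd_sub (I : Type) (s : seq I) (P : pred I) (F : I -> {set T}) C :
  (forall i, P i -> F i \subset C) -> \big[symd/set0]_(i <- s | P i) F i \subset C.
Proof.
by move=> h; apply: (big_ind (fun A => A \subset C)) => //; [apply: sub0set | move=> A B;
  exact: symd_sub].
Qed.

Lemma in_bigsymd (I : finType) (P : pred I) (F : I -> {set T}) x :
  (x \in \big[symd/set0]_(i | P i) F i) = odd #|[set i | P i & x \in F i]|.
Proof.
rewrite (big_morph (fun A => x \in A) (in_symd x) (in_set0 x)).
rewrite -sum1_card (big_morph odd oddD (erefl : odd 0 = false)).
rewrite big_mkcond [RHS]big_mkcond /=; apply: eq_bigr=> i _.
by rewrite inE; case: (P i) => //=; case: (x \in F i).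
Qed.

End SymDiff.

(** * Edge sets as chains over F_2 *)

Section Chains.
Variables (V W : finType) (ends : W -> {set V}).
Local Notation chain := {set W}.
Implicit Types (A B C D E F : chain) (x y z : V) (e f g : W).

(* An edge set is a vector over F_2: [symd] is addition, and the boundary [bd] is the set
   of vertices of odd degree. *)
Definition star A x : chain := [set e in A | x \in ends e].
Definition deg A x := #|star A x|.
Definition bd A : {set V} := [set x | odd (deg A x)].
Definition supp A : {set V} := \bigcup_(e in A) ends e.

Lemma in_bd A x : (x \in bd A) = odd (deg A x). Proof. by rewrite inE. Qed.

Lemma star_symd A B x : star (symd A B) x = symd (star A x) (star B x).
Proof. by apply/setP=> e; rewrite !inE; case: (x \in ends e); rewrite ?andbF ?andbT. Qed.

Lemma bd_symd A B : bd (symd A B) = symd (bd A) (bd B).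
Proof. by apply/setP=> x; rewrite in_symd !in_bd /deg star_symd odd_symd. Qed.

Lemma deg_set0 x : deg set0 x = 0.
Proof. by rewrite /deg (_ : star _ _ = set0) ?cards0 //; apply/setP=> e; rewrite !inE. Qed.

Lemma bd0 : bd set0 = set0.
Proof. by apply/setP=> x; rewrite in_bd inE deg_set0. Qed.

Lemma deg1 e x : deg [set e] x = (x \in ends e).
Proof.
rewrite /deg; case: (boolP (x \in ends e)) => h.
  rewrite (_ : star _ _ = [set e]) ?cards1 //.
  by apply/setP=> g; rewrite !inE; case: eqP => // ->; rewrite h.
rewrite (_ : star _ _ = set0) ?cards0 //.
by apply/setP=> g; rewrite !inE; case: eqP => // ->; rewrite (negPf h).
Qed.

Lemma bd1 e : bd [set e] = ends e.
Proof. by apply/setP=> x; rewrite in_bd deg1 oddb. Qed.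

Lemma bd_big (I : Type) (s : seq I) (P : pred I) (F : I -> chain) :
  bd (\big[@symd _/set0]_(i <- s | P i) F i) = \big[@symd _/set0]_(i <- s | P i) bd (F i).
Proof. exact: (big_morph bd bd_symd bd0). Qed.

Lemma bigsymd1 A : \big[@symd _/set0]_(e in A) [set e] = A.
Proof.
apply/setP=> e; rewrite in_bigsymd; case: (boolP (e \in A)) => hA.
  rewrite (_ : [set _ | _ & _] = [set e]) ?cards1 //.
  by apply/setP=> g; rewrite !inE (eq_sym e); case: eqP => [->|]; rewrite ?andbF ?hA.
rewrite (_ : [set _ | _ & _] = set0) ?cards0 //.
by apply/setP=> g; rewrite !inE (eq_sym e); case: eqP => [->|]; rewrite ?andbF ?(negPf hA).
Qed.

Lemma suppP A x : reflect (exists2 e, e \in A & x \in ends e) (x \in supp A).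
Proof. exact: bigcupP. Qed.

Lemma mem_supp e x A : e \in A -> x \in ends e -> x \in supp A.
Proof. by move=> he hx; apply/suppP; exists e. Qed.

Lemma suppS A B : A \subset B -> supp A \subset supp B.
Proof.
move=> /subsetP h; apply/subsetP=> x /suppP[e he hx].
by apply: mem_supp hx; apply: h.
Qed.

Lemma supp0 : supp set0 = set0.
Proof. exact: big_set0. Qed.

Lemma suppU A B : supp (A :|: B) = supp A :|: supp B.
Proof. exact: bigcup_setU. Qed.

Lemma supp1 e : supp [set e] = ends e.
Proof. exact: big_set1. Qed.

Lemma deg_supp A x : (0 < deg A x) = (x \in supp A).
Proof.
rewrite card_gt0; apply/set0Pn/suppP.
  by case=> e; rewrite inE => /andP[]; exists e.
by case=> e he hx; exists e; rewrite inE he.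
Qed.

Lemma deg0 A x : x \notin supp A -> deg A x = 0.
Proof. by rewrite -deg_supp -eqn0Ngt => /eqP. Qed.

Lemma degS A B x : A \subset B -> deg A x <= deg B x.
Proof.
move=> /subsetP h; apply: subset_leq_card; apply/subsetP=> e.
by rewrite !inE => /andP[/h -> ->].
Qed.

Lemma bd_supp A : bd A \subset supp A.
Proof. by apply/subsetP=> x; rewrite in_bd -deg_supp; case: (deg A x). Qed.

Lemma deg_disjU A B x : [disjoint A & B] -> deg (A :|: B) x = deg A x + deg B x.
Proof.
move=> h; rewrite /deg -cardsUI.
rewrite (_ : star A x :&: star B x = set0) ?cards0 ?addn0.
  by congr #|pred_of_set _|; apply/setP=> e; rewrite !inE andb_orl.
apply/setP=> e; rewrite !inE; case: (boolP (e \in A)) => //= hA.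
by rewrite (disjointFr h hA) andbF.
Qed.

Lemma sum_deg A (U : {set V}) :
  \sum_(x in U) deg A x = \sum_(e in A) #|ends e :&: U|.
Proof.
transitivity (\sum_(x in U) \sum_(e in A) (x \in ends e : nat)).
  apply: eq_bigr=> x _; rewrite /deg -sum1_card big_mkcond [RHS]big_mkcond /=.
  by apply: eq_bigr=> e _; rewrite inE; case: (e \in A); case: (x \in ends e).
rewrite exchange_big /=; apply: eq_bigr=> e _.
rewrite -sum1_card big_mkcond [RHS]big_mkcond /=.
by apply: eq_bigr=> x _; rewrite inE; case: (x \in U); case: (x \in ends e).
Qed.

Definition even_chain A := (A != set0) && (bd A == set0).
(** Minimal nonempty even edge sets are the edge sets of cycles. This form suits sums over F_2 and
    hides the cyclic order, which [circuit_struct] recovers. *)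
Definition circuit C := minset even_chain C.

Lemma circuit_bd C : circuit C -> bd C = set0.
Proof. by move/minsetp => /andP[_ /eqP]. Qed.
Lemma circuit_n0 C : circuit C -> C != set0.
Proof. by move/minsetp => /andP[]. Qed.
Lemma circuit_min C D : circuit C -> D \subset C -> bd D = set0 -> D = set0 \/ D = C.
Proof.
move=> hC hD hb; case: (eqVneq D set0) => [->|hn]; [by left|right].
by case/minsetP: hC => _; apply=> //; rewrite /even_chain hn hb eqxx.
Qed.
Lemma circuit_ex A : A != set0 -> bd A = set0 -> exists2 C, circuit C & C \subset A.
Proof.
move=> hn hb; have : even_chain A by rewrite /even_chain hn hb eqxx.
by case/minset_exists => C; exists C.
Qed.

Lemma circuit_ex_mem A e : bd A = set0 -> e \in A ->
  exists C, [/\ circuit C, C \subset A & e \in C].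
Proof.
elim: {A}_.+1 {-2}A (ltnSn #|A|) => // n IH A hn hb he.
have hA0 : A != set0 by apply/set0Pn; exists e.
have [C hC hCA] := circuit_ex hA0 hb.
case: (boolP (e \in C)) => heC; first by exists C.
have : exists K, [/\ circuit K, K \subset symd A C & e \in K].
  apply: IH; last by rewrite in_symd he (negPf heC).
  - rewrite symd_setD // cardsD (setIidPr hCA).
    have := subset_leq_card hCA; have : 0 < #|C| by rewrite card_gt0 circuit_n0.
    lia.
  - by rewrite bd_symd hb (circuit_bd hC) symdd.
case=> K [h1 h2 h3]; exists K; split=> //.
by apply: subset_trans h2 _; apply: symd_sub.
Qed.

(** Circuits are peeled off one at a time; each is contained in what remains, so removing it is
    adding it. The equation between cardinalities records that the circuits are edge-disjoint, and
    it is what makes the total length drop in [null_short]. *)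
Lemma circuit_decomp A : bd A = set0 ->
  exists s : seq chain, [/\ all circuit s, all (fun C : chain => C \subset A) s,
    \big[@symd _/set0]_(C <- s) C = A & \sum_(C <- s) #|C| = #|A|].
Proof.
elim: {A}_.+1 {-2}A (ltnSn #|A|) => // n IH A hn hb.
case: (eqVneq A set0) => [->|hA0].
  by exists [::]; rewrite /= !big_nil cards0.
have [C hC hCA] := circuit_ex hA0 hb.
have hc : #|symd A C| = #|A| - #|C| by rewrite symd_setD // cardsD (setIidPr hCA).
have hle := subset_leq_card hCA.
have h0 : 0 < #|C| by rewrite card_gt0 circuit_n0.
have [||s [h1 h2 h3 h4]] := IH (symd A C); first by rewrite hc; lia.
  by rewrite bd_symd hb (circuit_bd hC) symdd.
exists (C :: s); rewrite /= hC h1 hCA !big_cons h3 h4 hc; split=> //; last by rewrite subnKC.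
  by apply/allP=> D /(allP h2) hD; apply: subset_trans hD _; apply: symd_sub.
by rewrite symdC -symdA symdd symd0.
Qed.

Hypothesis ends2 : forall e, #|ends e| = 2.

(** Handshake lemma: each single edge has a boundary of two vertices, and parity is additive. *)
Lemma odd_bd A : odd #|bd A| = false.
Proof.
rewrite -(bigsymd1 A) bd_big.
rewrite (big_morph (fun B : {set V} => odd #|B|) (@odd_symd V) (_ : odd #|set0| = false)) ?cards0
  //.
by apply: (big_ind (fun b => b = false)) => // [_ _ -> ->|e _] //; rewrite bd1 ends2.
Qed.

Lemma ends_other e x : x \in ends e -> exists2 y, y != x & ends e = [set x; y].
Proof.
move=> hx; have /eqP/cards2P[a [b [hab he]]] := ends2 e.
move: hx; rewrite he !inE => /orP[/eqP ->|/eqP ->]; first by exists b; rewrite // eq_sym.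
by exists a; rewrite // setUC.
Qed.

Lemma ends_eq e x y : x \in ends e -> y \in ends e -> x != y -> ends e = [set x; y].
Proof.
move=> hx hy hxy; apply/esym/eqP; rewrite eqEcard ends2 cards2 hxy.
by rewrite subUset !sub1set hx hy.
Qed.

Lemma symd_pair x y : x != y -> symd [set x] [set y] = [set x; y].
Proof. by move=> h; rewrite symd_disj // disjoints1 inE. Qed.

Lemma symd_tri x y z : symd (symd [set x] [set y]) (symd [set y] [set z]) = symd [set x] [set z].
Proof. by rewrite -symdA symdK. Qed.

Lemma bd1_pair e x y : x \in ends e -> y \in ends e -> x != y ->
  bd [set e] = symd [set x] [set y].
Proof. by move=> hx hy hxy; rewrite bd1 (ends_eq hx hy hxy) symd_pair. Qed.

(* [U] and [D'] are the vertices and edges of the component of [a]. *)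
Lemma component D a : exists (D' : chain) (U : {set V}),
  [/\ D' \subset D, a \in U, bd D' = bd D :&: U,
      forall e x, e \in D -> x \in ends e -> x \in U -> e \in D'
    & forall x, (x \in U -> exists2 B : chain, B \subset D' & bd B = symd [set a] [set x]) /\ (x
      \in supp D' -> x \in U)].
Proof.
pose U := [set y | [exists B : chain, (B \subset D) && (bd B == symd [set a] [set y])]].
have aU : a \in U.
  by rewrite inE; apply/existsP; exists set0; rewrite sub0set bd0 symdd eqxx.
have step e y z : e \in D -> y \in ends e -> z \in ends e -> y \in U -> z \in U.
  move=> he hy hz hyU; case: (eqVneq y z) => [<- //|hyz].
  move: hyU; rewrite !inE => /existsP[B /andP[hB /eqP hb]].
  apply/existsP; exists (symd B [set e]); rewrite symd_sub ?sub1set //=.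
  by rewrite bd_symd hb (bd1_pair hy hz hyz) symd_tri.
pose D' := [set e in D | ends e \subset U].
have inD' e x : e \in D -> x \in ends e -> x \in U -> e \in D'.
  move=> he hx hxU; rewrite inE he; apply/subsetP=> z hz; exact: step hx hz hxU.
have sub : D' \subset D by apply/subsetP=> e; rewrite inE => /andP[].
(* No edge of [D] leaves [U], so intersecting with [D'] keeps every edge at a vertex of [U] and
   drops every other edge. *)
have bdI (B : chain) : B \subset D -> bd (B :&: D') = bd B :&: U.
  move=> hB; apply/setP=> x; rewrite in_setI !in_bd; case: (boolP (x \in U)) => hxU.
    rewrite andbT /deg; congr (odd #|pred_of_set _|); apply/setP=> e.
    rewrite !in_set; case: (boolP (e \in B)) => //= /(subsetP hB) he; rewrite he /=.
    case: (boolP (x \in ends e)) => hx; rewrite ?andbF // andbT.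
    by have := inD' _ _ he hx hxU; rewrite inE he.
  rewrite andbF deg0 //; apply: contra hxU => /suppP[e].
  by rewrite in_setI in_set => /and3P[_ _ /subsetP h]; apply: h.
exists D', U; split=> //; first by rewrite -bdI // (setIidPr sub).
move=> x; split=> [hx|/suppP[e]]; last first.
  by rewrite in_set => /andP[_ /subsetP h]; apply: h.
have := hx; rewrite inE => /existsP[B /andP[hB /eqP hb]].
exists (B :&: D'); first exact: subsetIr.
rewrite bdI // hb; apply/setP=> y; rewrite in_setI !in_symd !in_set1.
case: (eqVneq y a) => [->|_]; first by rewrite aU andbT.
by case: (eqVneq y x) => [->|_]; rewrite ?hx.
Qed.

(** The component of [a] has boundary [bd D :&: U], which is empty, so by minimality it is the whole
    circuit. *)
Lemma circuit_connected D a x : circuit D -> a \in supp D -> x \in supp D ->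
  exists2 B : chain, B \subset D & bd B = symd [set a] [set x].
Proof.
move=> hD /suppP[e he hae] hx.
have [D' [U [sub aU hb inD' con]]] := component D a.
have eD' := inD' _ _ he hae aU.
case: (circuit_min hD sub) => [|h|h]; first by rewrite hb (circuit_bd hD) set0I.
  by rewrite h inE in eD'.
rewrite -h in hx; have [c1 c2] := con x.
by have [B h1 h2] := c1 (c2 hx); exists B; rewrite // (subset_trans h1 sub).
Qed.


(* Strong circuit elimination in a binary matroid. *)
Lemma circuit_trans C D e f : circuit C -> circuit D -> e \in C -> f \in D ->
  ~~ [disjoint C & D] ->
  exists K, [/\ circuit K, K \subset C :|: D, e \in K & f \in K].
Proof.
elim: {C}_.+1 {-2}C (ltnSn #|C :|: D|) => // n IH C hn hC hD he hf hCD.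
case: (boolP (e \in D)) => heD; first by exists D; rewrite subsetUr.
case: (boolP (f \in C)) => hfC; first by exists C; rewrite subsetUl.
have [||K [hK hKs heK]] := @circuit_ex_mem (symd C D) e.
- by rewrite bd_symd (circuit_bd hC) (circuit_bd hD) symdd.
- by rewrite in_symd he (negPf heD).
have hKU : K \subset C :|: D by apply: subset_trans hKs (symd_subU _ _).
case: (boolP (f \in K)) => hfK; first by exists K.
have hKD : ~~ [disjoint K & D].
  apply/negP => h.
  have hKC : K \subset C.
    apply/subsetP=> g hg; move/subsetP: hKU => /(_ _ hg); rewrite inE.
    by rewrite (disjointFr h hg) orbF.
  case: (circuit_min hC hKC (circuit_bd hK)) => h'.
    by move: heK; rewrite h' inE.
  by move: hCD; rewrite -h' h.
have sub : K :|: D \subset C :|: D by rewrite subUset hKU subsetUr.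
have [hlt|hge] := ltnP #|K :|: D| #|C :|: D|.
  have [|L [h1 h2 h3 h4]] := IH K _ hK hD heK hf hKD; first exact: leq_trans hlt _.
  by exists L; split=> //; apply: subset_trans h2 sub.
(* If the union does not shrink, then [K] contains [C :\: D], so C + D + K is an even subset of [D]:
   empty or all of [D]. The first puts [f] into [K]; the second puts into [K] an edge common to [C]
   and [D]. *)
have heq : K :|: D = C :|: D by apply/eqP; rewrite eqEcard sub.
have : symd (symd C D) K \subset D.
  apply/subsetP=> g; rewrite !in_symd.
  case: (boolP (g \in D)) => // hgD; rewrite addbF.
  have : (g \in K :|: D) = (g \in C :|: D) by rewrite heq.
  by rewrite !inE (negPf hgD) !orbF => ->; rewrite addbb.
move=> h; case: (circuit_min hD h).
- by rewrite !bd_symd (circuit_bd hC) (circuit_bd hD) (circuit_bd hK) !symdd.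
- move=> h0; move: hfK; rewrite -(symd_eq0 h0) in_symd hf (negPf hfC) //.
- move=> h0; case/pred0Pn: hCD => g /= /andP[hg1 hg2].
  have : g \in symd (symd C D) K by rewrite h0.
  rewrite !in_symd hg1 hg2 /= => hgK.
  by move/subsetP: hKs => /(_ _ hgK); rewrite in_symd hg1 hg2.
Qed.

(* The homologically trivial chains once every circuit of length less than [l] is filled in. *)
Definition null E l A := exists s : seq chain,
  all (fun C : chain => [&& circuit C, C \subset E & #|C| < l]) s /\
  A = \big[@symd _/set0]_(C <- s) C.

Lemma null0 E l : null E l set0.
Proof. by exists [::]; rewrite big_nil. Qed.
Lemma null_symd E l A B : null E l A -> null E l B -> null E l (symd A B).
Proof.
move=> [s [hs ->]] [t [ht ->]]; exists (s ++ t); split; last by rewrite big_cat.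
by rewrite all_cat hs ht.
Qed.
Lemma null_big E l (I : Type) (s : seq I) (P : pred I) (F : I -> chain) :
  (forall i, P i -> null E l (F i)) -> null E l (\big[@symd _/set0]_(i <- s | P i) F i).
Proof.
by move=> h; apply: (big_ind (null E l)) => //; [apply: null0 | apply: null_symd].
Qed.
Lemma null_bd E l A : null E l A -> bd A = set0.
Proof.
move=> [s [hs ->]]; rewrite bd_big big_seq big1 // => C /(allP hs) /and3P[h _ _].
exact: circuit_bd.
Qed.
Lemma null_circuit E l C : circuit C -> C \subset E -> #|C| < l -> null E l C.
Proof. by move=> h1 h2 h3; exists [:: C]; rewrite big_seq1 /= h1 h2 h3. Qed.

Definition no_medium E l := forall C, circuit C -> C \subset E -> l <= #|C| -> l.*2 <= #|C|.

(** The circuits of a decomposition of [A] have fewer than 2l edges like [A] itself, and the gap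
    makes them shorter than l. *)
Lemma null_small E l A : no_medium E l -> A \subset E -> bd A = set0 -> #|A| < l.*2 ->
  null E l A.
Proof.
move=> hE hA hb hl; have [s [h1 h2 h3 h4]] := circuit_decomp hb.
exists s; split=> //; apply/allP=> C hC; rewrite (allP h1 _ hC) /=.
have hCA := allP h2 _ hC; have hCE := subset_trans hCA hA.
rewrite hCE ltnNge; apply/negP=> /(hE _ (allP h1 _ hC) hCE).
by have := subset_leq_card hCA; lia.
Qed.

(* While two circuits of the sum share an edge, replacing both by the circuits
   of their sum shortens the total length. *)
Lemma null_short E l A : no_medium E l -> null E l A -> A != set0 ->
  exists C, [/\ circuit C, C \subset A & #|C| < l].
Proof.
move=> hE [s [hs ->]].
elim: {s}_.+1 {-2}s (ltnSn (\sum_(C <- s) #|C|)) hs => // n IH s hn hs hA.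
case: s hn hs hA => [|c s] hn hs hA; first by rewrite big_nil eqxx in hA.
move: hs => /= /andP[/and3P[hc1 hc2 hc3] hs].
(* A circuit that shares no edge with the others survives intact in the sum, and is the one
   sought. *)
case: (boolP (all (fun d : chain => [disjoint c & d]) s)) => hd.
  exists c; split=> //; rewrite big_cons symd_disj ?subsetUl //.
  rewrite big_seq; apply: (big_ind (fun B : chain => [disjoint c & B])).
  - by rewrite -setI_eq0 setI0.
  - move=> B1 B2 h1 h2; apply/pred0P=> e /=; rewrite in_symd.
    by case: (boolP (e \in c)) => // he; rewrite (disjointFr h1 he) (disjointFr h2 he).
  - by move=> d /(allP hd).
have [d hds hcd] : exists2 d : chain, d \in s & ~~ [disjoint c & d].
  by case/allPn: hd => d; exists d.
have hp := perm_to_rem hds.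
have /and3P[hd1 hd2 hd3] := allP hs _ hds.
have hcdb : bd (symd c d) = set0 by rewrite bd_symd (circuit_bd hc1) (circuit_bd hd1) symdd.
have hcdE : symd c d \subset E by apply: symd_sub.
have hI : 0 < #|c :&: d| by rewrite card_gt0 setI_eq0.
have hcard := card_symd c d.
have hsm : #|symd c d| < l.*2 by clear -hcard hI hc3 hd3; lia.
have hlt : #|symd c d| < #|c| + #|d| by clear -hcard hI; lia.
have [t [h1 h2 h3 h4]] := circuit_decomp hcdb.
have eqs : \big[@symd _/set0]_(C <- c :: s) C = \big[@symd _/set0]_(C <- t ++ rem d s) C.
  by rewrite big_cons (perm_big _ hp) big_cons big_cat /= h3 symdA.
rewrite eqs in hA *; apply: IH => //.
  move: hn; rewrite big_cons (perm_big _ hp) big_cons big_cat /= h4.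
  by rewrite addnA ltnS; apply: leq_trans; rewrite ltn_add2r.
rewrite all_cat; apply/andP; split; last first.
  by apply/allP=> C /mem_rem; apply: (allP hs).
apply/allP=> C hC; have hCs := allP h2 _ hC; rewrite (allP h1 _ hC) /=.
have hCE := subset_trans hCs hcdE; rewrite hCE ltnNge.
apply/negP=> /(hE _ (allP h1 _ hC) hCE) h.
by have := leq_trans hsm h; rewrite ltnNge subset_leq_card.
Qed.

Lemma null_circuit_short E l Z : no_medium E l -> circuit Z -> null E l Z -> #|Z| < l.
Proof.
move=> hE hZ hn; have [C [h1 h2 h3]] := null_short hE hn (circuit_n0 hZ).
case: (circuit_min hZ h2 (circuit_bd h1)) => h; last by rewrite -h.
by have := circuit_n0 h1; rewrite h eqxx.
Qed.

(* Adding the closed chains [B x + B y + xy] over the edges of [A] cancels each [B x]. *)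
Lemma sum_cone A (B : V -> chain) : bd A = set0 ->
  \big[@symd _/set0]_(e in A) symd [set e] (\big[@symd _/set0]_(x in ends e) B x) = A.
Proof.
move=> hA; rewrite big_split /= bigsymd1.
rewrite (exchange_big_dep predT) //= big1 ?symd0 // => x _.
apply/setP=> e; rewrite in_bigsymd inE.
case: (boolP (e \in B x)) => h; last first.
  by rewrite (_ : [set _ | _ & _] = set0) ?cards0 //; apply/setP=> g; rewrite !inE andbF.
rewrite (_ : [set _ | _ & _] = star A x); last by apply/setP=> g; rewrite !inE andbT.
by rewrite -[odd _]in_bd hA inE.
Qed.

End Chains.

(** * Paths, circuits and forests *)

Section Paths.
Variables (V W : finType) (ends : W -> {set V}).
Hypothesis ends2 : forall e, #|ends e| = 2.
Local Notation chain := {set W}.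
Local Notation bd := (bd ends).
Local Notation deg := (deg ends).
Local Notation supp := (supp ends).
Local Notation circuit := (circuit ends).
Implicit Types (A B C D E F P T : chain) (x y z a b : V) (e f g : W).

(** The counterpart of [circuit] for paths between distinct [a] and [b]; [minpath_struct] recovers
    the order of the vertices. *)
Definition minpath a b P := minset (fun B => bd B == symd [set a] [set b]) P.

Lemma minpath_bd a b P : minpath a b P -> bd P = symd [set a] [set b].
Proof. by move/minsetp => /eqP. Qed.

Lemma minpath_min a b P B : minpath a b P -> B \subset P -> bd B = symd [set a] [set b] -> B = P.
Proof. by case/minsetP=> _ h hB hb; apply: h => //; apply/eqP. Qed.

Definition acyclic T := [forall D : chain, (D \subset T) && (bd D == set0) ==> (D == set0)].

Lemma acyclicP T : reflect (forall D, D \subset T -> bd D = set0 -> D = set0) (acyclic T).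
Proof.
apply: (iffP forallP) => [h D h1 h2|h D].
  by have := h D; rewrite h1 h2 eqxx => /eqP.
by apply/implyP=> /andP[h1 /eqP h2]; apply/eqP; apply: h.
Qed.

Lemma acyclicS A B : A \subset B -> acyclic B -> acyclic A.
Proof.
move=> hAB /acyclicP h; apply/acyclicP=> D hD; apply: h; exact: subset_trans hD hAB.
Qed.

Lemma minpath_acyclic a b P : minpath a b P -> acyclic P.
Proof.
move=> hP; apply/acyclicP=> D hD hb.
have := minpath_min hP (symd_sub (subxx P) hD); rewrite bd_symd hb symd0.
by move=> /(_ (minpath_bd hP)) h; rewrite -(symdK P D) h symdd.
Qed.

(** By the handshake lemma the component of [a] has a second odd vertex, which can only be [b]. It
    then has the same boundary as [P] and equals [P] by minimality. *)
Lemma minpath_connected a b P x : a != b -> minpath a b P -> x \in supp P ->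
  exists2 B : chain, B \subset P & bd B = symd [set a] [set x].
Proof.
move=> hab hP hx.
have [D' [U [sub aU hb inD' con]]] := component ends2 P a.
have bU : b \in U.
  apply: contraT => hbU; have := odd_bd ends2 D'; rewrite hb (minpath_bd hP).
  rewrite (_ : _ :&: _ = [set a]) ?cards1 //.
  apply/setP=> y; rewrite in_setI in_symd !in_set1.
  case: (eqVneq y a) => [->|_]; first by rewrite aU (negPf hab).
  by case: (eqVneq y b) => [->|//]; rewrite (negPf hbU).
have h : D' = P.
  apply: (minpath_min hP sub); rewrite hb (minpath_bd hP).
  apply/setP=> y; rewrite in_setI !in_symd !in_set1.
  case: (eqVneq y a) => [->|_]; first by rewrite aU andbT.
  by case: (eqVneq y b) => [->|//]; rewrite bU.
rewrite -h in hx *; have [c1 c2] := con x.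
exact: c1 (c2 hx).
Qed.

Definition adj D x y := [exists e in D, ends e == [set x; y]].

Lemma adjS A B x y : A \subset B -> adj A x y -> adj B x y.
Proof.
by move=> /subsetP h /exists_inP[e he hx]; apply/exists_inP; exists e => //; apply: h.
Qed.

(** Induction on the number of edges: the edge from [a] to some [a'] is split off, and what is left
    is a minimal chain from [a'] to [b] that avoids [a]. *)
Lemma minpath_struct a b P : a != b -> minpath a b P ->
  [/\ deg P a = 1, deg P b = 1,
      forall x, x \in supp P -> x != a -> x != b -> deg P x = 2
    & exists p, [/\ path (adj P) a p, last a p = b, uniq (a :: p),
                    size p = #|P| & supp P =i a :: p]].
Proof.
elim: {P}_.+1 {-2}P (ltnSn #|P|) a => // n IH P hn a hab hP.
have aS : a \in supp P.
  apply: (subsetP (bd_supp ends P)); rewrite (minpath_bd hP) in_symd !in_set1 eqxx.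
  by rewrite (negPf hab).
case/suppP: aS => e he hae; have [a' ha' hee] := ends_other ends2 hae.
have a'e : a' \in ends e by rewrite hee !inE eqxx orbT.
have haa' : a != a' by rewrite eq_sym.
have bde := bd1_pair ends2 hae a'e haa'.
pose Q := P :\ e.
have PQ : P = e |: Q by rewrite setD1K.
have eQ : e \notin Q by rewrite !inE eqxx.
have degP x : deg P x = (x \in ends e) + deg Q x.
  by rewrite PQ deg_disjU ?deg1 // disjoints1.
have QP : symd [set e] P = Q.
  by rewrite symdC symd_setD ?sub1set //.
have bdQ : bd Q = symd [set a'] [set b].
  by rewrite -QP bd_symd bde (minpath_bd hP) (symdC [set a]) symd_tri.
have cPQ : #|P| = #|Q|.+1 by rewrite PQ cardsU1 eQ.
have suppPQ : supp P = ends e :|: supp Q by rewrite PQ suppU supp1.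
have adje : adj P a a' by apply/exists_inP; exists e => //; rewrite hee.
case: (eqVneq a' b) => [a'b|ha'b].
  have Pe : [set e] = P.
    by apply: (minpath_min hP); rewrite ?sub1set // bde a'b.
  rewrite -Pe !deg1 hae -a'b a'e; split=> //.
    by move=> x; rewrite supp1 hee !inE => /orP[] /eqP->; rewrite eqxx.
  exists [:: a']; rewrite /= !inE haa' cards1 andbT Pe adje; split=> //.
  by move=> x; rewrite -Pe supp1 hee !inE.
have hQ : minpath a' b Q.
  apply/minsetP; split=> [|B /eqP hb hB]; first exact/eqP.
  have eB : e \notin B by apply: contra eQ; apply: (subsetP hB).
  have hs : [set e] :|: B = symd [set e] B by rewrite symd_disj // disjoints1.
  have : e |: B = P.
    apply: (minpath_min hP); first by rewrite subUset sub1set he (subset_trans hB) // subD1set.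
    by rewrite hs bd_symd bde hb symd_tri.
  by move=> h; rewrite /Q -h setU1K.
(* A chain in [Q] from [a'] to [a], added to [Q], would join [a] to [b] inside [P] without using
   [e]. *)
have aQ : a \notin supp Q.
  apply/negP=> /(minpath_connected ha'b hQ)[B hB hb].
  have : symd Q B = P.
    apply: (minpath_min hP).
      by apply: subset_trans (symd_sub (subxx Q) hB) (subD1set _ _).
    by rewrite bd_symd bdQ hb symdC (symdC [set a']) symd_tri.
  move=> h; move: he; rewrite -h in_symd (negPf eQ) /= => /(subsetP hB) h'.
  by rewrite h' in eQ.
have [|d1 d2 d3 [p [p1 p2 p3 p4 p5]]] := IH Q _ a' ha'b hQ; first by rewrite -cPQ.
have be : b \notin ends e by rewrite hee !inE negb_or eq_sym hab eq_sym.
split.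
- by rewrite degP hae (deg0 aQ).
- by rewrite degP (negPf be) d2.
- move=> x; rewrite suppPQ inE degP => hx hxa hxb.
  case: (eqVneq x a') => [->|hxa']; first by rewrite a'e d1.
  have hxe : x \notin ends e by rewrite hee !inE negb_or hxa.
  by rewrite (negPf hxe) d3 //; move: hx; rewrite (negPf hxe).
- exists (a' :: p); split=> //.
  + rewrite /= adje; apply: sub_path p1 => x y; apply: adjS; exact: subD1set.
  + by rewrite cons_uniq p3 andbT -p5.
  + by rewrite /= p4 cPQ.
  + move=> x; rewrite suppPQ inE p5 hee !inE.
    by case: (x == a); case: (x == a').
Qed.

Lemma circuit_minpath C e a b : circuit C -> e \in C -> ends e = [set a; b] -> a != b ->
  minpath a b (C :\ e).
Proof.
move=> hC he hee hab.
have bde : bd [set e] = symd [set a] [set b] by rewrite bd1 hee symd_pair.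
have hCe : C :\ e = symd C [set e] by rewrite symd_setD ?sub1set.
apply/minsetP; split; first by rewrite hCe bd_symd (circuit_bd hC) sym0d bde.
move=> B /eqP hb hB.
have eB : e \notin B by apply/negP=> /(subsetP hB); rewrite !inE eqxx.
have hs : [set e] :|: B = symd [set e] B by rewrite symd_disj // disjoints1.
case: (circuit_min hC (_ : [set e] :|: B \subset C)).
- by rewrite subUset sub1set he (subset_trans hB) // subD1set.
- by rewrite hs bd_symd bde hb symdd.
- by move=> h; have : e \in [set e] :|: B; [rewrite !inE eqxx | rewrite h inE].
- by move=> <-; rewrite setU1K.
Qed.

Lemma circuit_struct C : circuit C ->
  (forall x, x \in supp C -> deg C x = 2) /\
  exists s, [/\ cycle (adj C) s, uniq s, size s = #|C| & supp C =i s].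
Proof.
move=> hC; have [e he] := set0Pn _ (circuit_n0 hC).
have /eqP/cards2P[a [b [hab hee]]] := ends2 e.
have hP := circuit_minpath hC he hee hab.
have [d1 d2 d3 [p [p1 p2 p3 p4 p5]]] := minpath_struct hab hP.
have CP : C = e |: (C :\ e) by rewrite setD1K.
have degP x : deg C x = (x \in ends e) + deg (C :\ e) x.
  by rewrite {1}CP deg_disjU ?deg1 // disjoints1 !inE eqxx.
have sC : supp C = supp (C :\ e).
  rewrite {1}CP suppU supp1; apply/setUidPr; rewrite hee subUset !sub1set.
  by rewrite -!deg_supp d1 d2.
split=> [x hx|].
  rewrite degP hee !inE; case: (eqVneq x a) => [->|hxa]; first by rewrite d1.
  by case: (eqVneq x b) => [->|hxb]; [rewrite d2 | rewrite d3 // -sC].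
exists (a :: p); split=> //.
- rewrite /= rcons_path p2; apply/andP; split.
    by apply: sub_path p1 => x y; apply: adjS; exact: subD1set.
  by apply/exists_inP; exists e => //; rewrite hee setUC.
- by rewrite /= p4 [in RHS]CP cardsU1 !inE eqxx.
- by rewrite sC.
Qed.

Lemma circuit_deg C x : circuit C -> x \in supp C -> deg C x = 2.
Proof. by move=> /circuit_struct[h _]; apply: h. Qed.

Lemma card_supp_circuit C : circuit C -> #|supp C| = #|C|.
Proof.
move=> /circuit_struct[_ [s [_ h1 h2 h3]]].
by rewrite -h2 (eq_card h3); apply/card_uniqP.
Qed.

(** On subsets of an acyclic [T] the map [bd] is injective, and its values are subsets of [U];
    compare the sizes of the two power sets. *)
Lemma acyclic_card T (U : {set V}) : acyclic T -> supp T \subset U -> #|T| <= #|U|.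
Proof.
move=> /acyclicP hT hU; rewrite -(leq_exp2l _ _ (ltnSn 1)) -!card_powerset.
rewrite -(@card_in_imset _ _ bd) => [|A B]; last first.
  rewrite !powersetE => hA hB h; apply: symd_eq0; apply: hT; first exact: symd_sub.
  by rewrite bd_symd h symdd.
apply: subset_leq_card; apply/subsetP=> _ /imsetP[A hA ->]; move: hA; rewrite !powersetE => hA.
exact: subset_trans (bd_supp _ _) (subset_trans (suppS _ hA) hU).
Qed.

Definition max_acyclic F T :=
  [/\ T \subset F, acyclic T & forall e, e \in F -> e \notin T -> ~~ acyclic (e |: T)].

Lemma max_acyclic_ex F A : A \subset F -> acyclic A -> exists2 T, max_acyclic F T & A \subset T.
Proof.
move=> hA1 hA2.
have [|T] := @maxset_exists _ (fun T : chain => (T \subset F) && acyclic T) A.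
  by rewrite hA1.
case/maxsetP=> /andP[h1 h2] h3 h4; exists T => //; split=> // e he heT.
apply/negP=> h; move: (heT); rewrite -(h3 (e |: T)) ?subsetUr ?inE ?eqxx //.
by rewrite subUset sub1set he h1.
Qed.

(* The fundamental circuits of [T] span an F_2-space of dimension [#|F :\: T|]
   on which restriction to [F :\: T0] is injective. *)
Lemma max_acyclic_card F T T0 : max_acyclic F T -> acyclic T0 -> #|F :\: T| <= #|F :\: T0|.
Proof.
case=> hTF /acyclicP hT hmax /acyclicP hT0.
have hC e : exists C, e \in F :\: T -> [/\ C \subset e |: T, bd C = set0 & e \in C].
  case: (boolP (e \in F :\: T)) => [|_]; last by exists set0.
  rewrite !inE => /andP[h1 h2]; have := hmax e h2 h1.
  rewrite negb_forall => /existsP[D]; rewrite negb_imply => /andP[/andP[d1 /eqP d2] d3].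
  exists D => _; split=> //; apply: contraT => he; case/negP: d3; apply/eqP; apply: hT => //.
  apply/subsetP=> f hf; move/subsetP: d1 => /(_ _ hf); rewrite !inE.
  by case: eqP => // hfe; rewrite -hfe hf in he.
have [Ce hCe] := fin_all_exists hC.
pose S (I : chain) := \big[@symd _/set0]_(e in I) Ce e.
have memS (I : chain) e : I \subset F :\: T -> e \in F :\: T -> (e \in S I) = (e \in I).
  move=> hI he; rewrite in_bigsymd; case: (boolP (e \in I)) => heI.
    rewrite (_ : [set _ | _ & _] = [set e]) ?cards1 //; apply/setP=> f; rewrite !inE.
    case: eqP => [->|/eqP hfe]; first by rewrite heI; case: (hCe e he).
    case: (boolP (f \in I)) => //= hf; case: (hCe f (subsetP hI _ hf)) => h1 _ _.
    apply: contraTF he => /(subsetP h1); rewrite !inE eq_sym (negPf hfe) /= => ->.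
    by [].
  rewrite (_ : [set _ | _ & _] = set0) ?cards0 //; apply/setP=> f; rewrite !inE.
  case: (boolP (f \in I)) => //= hf; case: (hCe f (subsetP hI _ hf)) => h1 _ _.
  apply: contraTF he => /(subsetP h1); rewrite !inE.
  by case: eqP => [hef|_ /= -> //]; rewrite hef hf in heI.
have bdS (I : chain) : I \subset F :\: T -> bd (S I) = set0.
  by move=> hI; rewrite bd_big big1 // => e /(subsetP hI) /hCe[].
have SF (I : chain) : I \subset F :\: T -> S I \subset F.
  move=> hI; apply: bigsymd_sub => e /(subsetP hI) he; have [h1 _ _] := hCe e he.
  by apply: subset_trans h1 _; rewrite subUset hTF sub1set andbT; move: he; rewrite inE => /andP[].
rewrite -(leq_exp2l _ _ (ltnSn 1)) -!card_powerset.
(* If [S I] and [S J] agree outside [T0], their sum is an even subset of [T0], hence empty; and [I]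
   is read off [S I] as its trace on [F :\: T]. *)
rewrite -(@card_in_imset _ _ (fun I => S I :&: (F :\: T0))) => [|I J]; last first.
  rewrite !powersetE => hI hJ h.
  have h0 : S I = S J.
    apply: symd_eq0; apply: hT0; last by rewrite bd_symd !bdS ?symdd.
    apply/subsetP=> e he; apply: contraT => heT0.
    have heF : e \in F by apply: (subsetP (symd_sub (SF _ hI) (SF _ hJ))).
    move/setP: h => /(_ e); rewrite !in_setI !in_setD heT0 heF !andbT => h.
    by move: he; rewrite in_symd h addbb.
  apply/setP=> e; case: (boolP (e \in F :\: T)) => he.
    by rewrite -(memS I) // h0 memS.
  by rewrite (contraNF (subsetP hI e) he) (contraNF (subsetP hJ e) he).
apply: subset_leq_card; apply/subsetP=> _ /imsetP[I _ ->]; rewrite powersetE.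
exact: subsetIr.
Qed.

End Paths.

(** * Disjoint circuits in subcubic graphs *)

Section Simonovits.
Variables (V W : finType) (ends : W -> {set V}).
Hypothesis ends2 : forall e, #|ends e| = 2.
Local Notation chain := {set W}.
Local Notation bd := (bd ends).
Local Notation deg := (deg ends).
Local Notation supp := (supp ends).
Local Notation circuit := (circuit ends).
Local Notation acyclic := (acyclic ends).
Implicit Types (A B C D E F P T : chain) (x y z a b : V) (e f g : W).

Definition branch F : {set V} := [set x | deg F x == 3].

Lemma sum_deg_branch F (U : {set V}) : (forall x, x \in U -> 1 < deg F x) ->
  #|U|.*2 + #|branch F :&: U| <= \sum_(x in U) deg F x.
Proof.
move=> hU; apply: leq_trans (_ : \sum_(x in U) (2 + (x \in branch F)) <= _).
  rewrite big_split /= sum_nat_const muln2 leq_add2l -sum1_card.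
  rewrite big_mkcond [X in _ <= X]big_mkcond /=; apply: leq_sum=> x _.
  by rewrite inE; case: (x \in U); case: (x \in branch F).
by apply: leq_sum=> x /hU; rewrite inE; case: eqP => [->|].
Qed.

(** All degrees on the support are at least 2, so 2|supp F| + |branch F| is at most the degree sum
    2|F|, while |T| is at most |supp F|. *)
Lemma card_branch F T : (forall x, deg F x != 1) -> T \subset F -> acyclic T ->
  #|branch F| <= (#|F :\: T|).*2.
Proof.
move=> h1 hTF hT.
have c1 : #|F| = #|T| + #|F :\: T| by rewrite -(cardsID T F) (setIidPr hTF).
have c2 : #|T| <= #|supp F| by apply: (acyclic_card hT); apply: suppS.
have c3 : #|supp F|.*2 + #|branch F| <= \sum_(x in supp F) deg F x.
  rewrite -[in #|branch _|](_ : branch F :&: supp F = branch F).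
    by apply: sum_deg_branch => x; rewrite -deg_supp; have := h1 x; case: (deg F x) => [|[]].
  by apply/setIidPl/subsetP=> x; rewrite inE -deg_supp => /eqP->.
have c4 : \sum_(x in supp F) deg F x = #|F|.*2.
  rewrite sum_deg -muln2 -sum_nat_const; apply: eq_bigr=> f hf.
  by rewrite (setIidPl _) ?ends2 //; apply/subsetP=> x; apply: mem_supp.
clear -c1 c2 c3 c4; lia.
Qed.

(** * Exponential growth of balls around a branch vertex *)

Section Ball.
Variables (F : chain) (root : V).
Hypothesis deg_neq1 : forall x, deg F x != 1.
Hypothesis root_branch : root \in branch F.

(* The distance from [root] counts branch vertices only. *)
Definition ball t : {set V} := [set x in supp F | [exists B : chain,
  [&& B \subset F, bd B == symd [set root] [set x] &
      #|branch F :&: (root |: supp B)| <= t]]].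

Lemma ballP t x : reflect (x \in supp F /\ exists B : chain,
    [/\ B \subset F, bd B = symd [set root] [set x] &
        #|branch F :&: (root |: supp B)| <= t]) (x \in ball t).
Proof.
rewrite inE; apply: (iffP andP) => -[h1].
  by case/existsP=> B /and3P[h2 /eqP h3 h4]; split=> //; exists B.
by case=> B [h2 h3 h4]; split=> //; apply/existsP; exists B; rewrite h2 h3 eqxx.
Qed.

Lemma ball_incl t : ball t \subset ball t.+1.
Proof.
apply/subsetP=> x /ballP[h1 [B [h2 h3 h4]]]; apply/ballP; split=> //.
by exists B; split=> //; apply: leqW.
Qed.

Lemma mem_path_supp B x : bd B = symd [set root] [set x] -> x \in root |: supp B.
Proof.
move=> hb; rewrite in_setU1; case: eqVneq => //= hx.
by apply: (subsetP (bd_supp ends B)); rewrite hb in_symd !in_set1 (negPf hx) eqxx.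
Qed.

Lemma ball_step t e x y : e \in F -> x \in ends e -> y \in ends e -> x \in ball t ->
  y \in ball (t + (y \in branch F)).
Proof.
move=> he hx hy hxt; have hyF := mem_supp he hy.
case: (eqVneq x y) => [<-|hxy].
  by case: (x \in branch F); rewrite ?addn0 // addn1; apply: (subsetP (ball_incl t)).
case/ballP: hxt => _ [B [h2 h3 h4]]; apply/ballP; split=> //; exists (symd B [set e]).
split; first by apply: symd_sub; rewrite ?sub1set.
  by rewrite bd_symd h3 (bd1_pair ends2 hx hy hxy) symd_tri.
apply: leq_trans (_ : #|(branch F :&: (root |: supp B)) :|: (branch F :&: [set y])| <= _).
  apply: subset_leq_card; rewrite -setIUr; apply: setIS.
  rewrite subUset; apply/andP; split; first by rewrite sub1set !inE eqxx.
  apply: subset_trans (suppS _ (symd_subU _ _)) _; rewrite suppU supp1.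
  rewrite (ends_eq ends2 hx hy hxy) !subUset !sub1set; apply/and3P; split.
  - by apply: subset_trans (subsetUl _ _); apply: subsetUr.
  - by rewrite in_setU (mem_path_supp h3).
  - by rewrite in_setU in_set1 eqxx orbT.
apply: leq_trans (leq_card_setU _ _) _; apply: leq_add => //.
case: (boolP (y \in branch F)) => hyB.
  by apply: leq_trans (subset_leq_card (subsetIr _ _)) _; rewrite cards1.
rewrite (_ : _ :&: _ = set0) ?cards0 //; apply/setP=> z; rewrite !in_setI in_set1 in_set0.
by case: eqP => [->|]; rewrite ?andbF // (negPf hyB).
Qed.

Variable m : nat.
Hypothesis no_small : forall C, circuit C -> C \subset F -> m.*2.+2 < #|branch F :&: supp C|.

Definition touching (U : {set V}) : chain := [set e in F | ~~ [disjoint ends e & U]].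

(* Two paths from [root] and an edge form a closed chain with few branch vertices, which
   must vanish; [sum_cone] then kills every closed chain. *)
Lemma touching_acyclic t : t <= m -> acyclic (touching (ball t)).
Proof.
move=> ht.
(* [sum_cone] needs one chain per vertex, used for all edges at it; it is chosen with the sharper
   bound t whenever the vertex already lies in [ball t]. *)
have hB x : exists B : chain, x \in ball t.+1 -> [/\ B \subset F,
    bd B = symd [set root] [set x], #|branch F :&: (root |: supp B)| <= t.+1 &
    x \in ball t -> #|branch F :&: (root |: supp B)| <= t].
  case: (boolP (x \in ball t)) => h1.
    by case/ballP: (h1) => _ [B [b1 b2 b3]]; exists B; split=> //; apply: leqW.
  case: (boolP (x \in ball t.+1)) => h2; last by exists set0.
  by case/ballP: h2 => _ [B [b1 b2 b3]]; exists B; split.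
have [B hBx] := fin_all_exists hB.
apply/acyclicP=> D hD hb; rewrite -(sum_cone B hb) big1 // => e he.
have := subsetP hD _ he; rewrite inE => /andP[heF].
case/pred0Pn=> x /= /andP[hxe hxt].
have [y hyx hee] := ends_other ends2 hxe.
have hye : y \in ends e by rewrite hee !inE eqxx orbT.
have hxt1 := subsetP (ball_incl t) _ hxt.
have hyt1 : y \in ball t.+1.
  have := ball_step heF hxe hye hxt; case: (y \in branch F); rewrite ?addn0 ?addn1 //.
  exact: (subsetP (ball_incl t)).
rewrite hee big_setU1 ?big_set1 ?in_set1 1?eq_sym //=.
have [b1 b2 _ /(_ hxt) b3] := hBx x hxt1; have [c1 c2 c3 _] := hBx y hyt1.
apply/eqP; apply: contraT => hn.
have hxy : x != y by rewrite eq_sym.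
have [|C hC hCs] := @circuit_ex _ _ ends _ hn.
  by rewrite !bd_symd b2 c2 (bd1_pair ends2 hxe hye hxy) (symdC [set root]) symd_tri symdd.
have /(no_small hC) : C \subset F.
  by apply: subset_trans hCs _; rewrite !symd_sub ?sub1set.
(* The end [x] lies in [ball t] and the end [y] in [ball t.+1], so the closed chain meets at most t
   + (t + 1) branch vertices. *)
rewrite ltnNge => /negP[]; apply: leq_trans (_ : t + t.+1 <= _); last by clear -ht; lia.
apply: leq_trans (leq_add b3 c3); apply: leq_trans (leq_card_setU _ _).
apply: subset_leq_card; rewrite -setIUr; apply: setIS.
apply: subset_trans (suppS _ hCs) _.
apply: subset_trans (suppS _ (symd_subU _ _)) _; rewrite suppU supp1 hee subUset.
apply/andP; split.
  by rewrite subUset !sub1set; apply/andP; split;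
    rewrite in_setU ?(mem_path_supp b2) ?(mem_path_supp c2) ?orbT.
apply: subset_trans (suppS _ (symd_subU _ _)) _; rewrite suppU.
by apply: setUSS; apply: subsetUr.
Qed.

(** Count degrees in the ball R. Their sum is at least 2|R| plus the number of branch vertices in R.
    It also equals the number of edges touching R plus the number inside R; both sets are acyclic,
    so the sum is at most (|R| + |N|) + |R|, where N is the set of new branch vertices. Hence N is
    at least as large as the set of branch vertices in R. *)
Lemma ball_double t : t <= m ->
  (#|branch F :&: ball t|).*2 <= #|branch F :&: ball t.+1|.
Proof.
move=> ht; set R := ball t; set N := (branch F :&: ball t.+1) :\: R.
pose I := [set e in F | ends e \subset R].
have hT := touching_acyclic ht.
have hdeg : \sum_(x in R) deg F x = #|touching R| + #|I|.
  rewrite sum_deg -!sum1_card !(big_mkcond (mem (touching R))) (big_mkcond (mem I)) /=.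
  rewrite (big_mkcond (mem F)) -big_split /=; apply: eq_bigr=> e _.
  rewrite !in_set; case: (boolP (e \in F)) => //= he.
  have /eqP/cards2P[a [b [hab hee]]] := ends2 e; rewrite hee.
  rewrite subUset !sub1set.
  have -> : [disjoint [set a; b] & R] = ~~ ((a \in R) || (b \in R)).
    rewrite -setI_eq0 setIUl setU_eq0 !setI_eq0 !disjoints1 negb_or //.
  have -> : #|[set a; b] :&: R| = (a \in R) + (b \in R).
    rewrite -sum1_card (eq_bigl (fun x => (x \in [set a; b]) && (x \in R))); last by move=> x;
      rewrite in_setI.
    rewrite big_mkcondr /= big_setU1 ?big_set1 ?in_set1 //=.
  by case: (a \in R); case: (b \in R).
(* A neighbour of the ball that is no branch vertex lies at no greater distance, so all outer ends
   of touching edges belong to [N]. *)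
have c1 : #|touching R| <= #|R| + #|N|.
  apply: leq_trans (leq_card_setU _ _); apply: (acyclic_card hT).
  apply/subsetP=> y /suppP[e]; rewrite inE => /andP[he /pred0Pn[x /= /andP[hxe hxt]]] hye.
  rewrite in_setU in_setD in_setI; case: (boolP (y \in R)) => //= hyR.
  have := ball_step he hxe hye hxt; case: (boolP (y \in branch F)) => hyB.
    by rewrite addn1.
  by rewrite addn0 (negPf hyR).
have c2 : #|I| <= #|R|.
  apply: (@acyclic_card _ _ ends).
    apply: acyclicS hT; apply/subsetP=> e; rewrite !inE => /andP[-> h] /=.
    apply/pred0Pn; have : 0 < #|ends e| by rewrite ends2.
    by case/card_gt0P=> x hx; exists x; rewrite /= hx (subsetP h).
  by apply/subsetP=> x /suppP[e]; rewrite inE => /andP[_ /subsetP h] /h.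
have c3 : #|R|.*2 + #|branch F :&: R| <= \sum_(x in R) deg F x.
  apply: sum_deg_branch => x /ballP[hx _]; have := deg_neq1 x.
  by rewrite -deg_supp in hx; case: (deg F x) hx => [|[]].
have c4 : #|N| + #|branch F :&: R| = #|branch F :&: ball t.+1|.
  rewrite -(cardsID R (branch F :&: ball t.+1)) addnC; congr (_ + _).
  congr #|pred_of_set _|; apply/setP=> x; rewrite !in_setI -andbA; congr (_ && _).
  by case: (boolP (x \in R)) => [/(subsetP (ball_incl t)) ->|]; rewrite ?andbF.
rewrite -c4; rewrite hdeg in c3; clear -c1 c2 c3; lia.
Qed.

Lemma ball_exp t : t <= m -> 2 ^ t <= #|branch F :&: ball t.+1|.
Proof.
elim: t => [_|t IH ht]; last first.
  by apply: leq_trans (ball_double ht); rewrite expnS mul2n leq_double IH // ltnW.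
rewrite expn0 card_gt0; apply/set0Pn; exists root; rewrite in_setI root_branch.
apply/ballP; split; first by rewrite -deg_supp; move: root_branch; rewrite inE => /eqP->.
exists set0; rewrite sub0set bd0 symdd; split=> //.
by apply: leq_trans (subset_leq_card (subsetIr _ _)) _; rewrite supp0 setU0 cards1.
Qed.

End Ball.

(** Otherwise the balls around a branch vertex double until they hold 2^m branch vertices. Without
    branch vertices all degrees are 0 or 2, [F] itself is even, and any circuit serves. *)
Lemma short_circuit F m : F != set0 -> (forall x, deg F x != 1) -> (forall x, deg F x <= 3) ->
  #|branch F| < 2 ^ m ->
  exists C, [/\ circuit C, C \subset F & #|branch F :&: supp C| <= m.*2.+2].
Proof.
move=> hF h1 h3 hm.
case: (boolP [exists C : chain, [&& circuit C, C \subset F & #|branch F :&: supp C| <= m.*2.+2]]).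
  by case/existsP=> C /and3P[c1 c2 c3]; exists C.
rewrite negb_exists => /forallP hno.
have no_small C : circuit C -> C \subset F -> m.*2.+2 < #|branch F :&: supp C|.
  by move=> c1 c2; have := hno C; rewrite c1 c2 /= -ltnNge.
case: (eqVneq (branch F) set0) => [h0|/set0Pn[root hr]].
  have [|C hC hCF] := @circuit_ex _ _ ends _ hF.
    apply/setP=> x; rewrite in_bd inE; have := h1 x; have := h3 x.
    have : x \notin branch F by rewrite h0 inE.
    by rewrite inE; case: (deg F x) => [|[|[|[|]]]].
  by exists C; split=> //; rewrite h0 set0I cards0.
have := ball_exp h1 hr no_small (leqnn m).
by rewrite leqNgt => /negP[]; apply: leq_ltn_trans hm; apply: subset_leq_card; apply: subsetIl.
Qed.

Definition packing E l k := exists s : seq chain,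
  [/\ size s = k, all (fun C => [&& circuit C, C \subset E & l <= #|C|]) s &
      pairwise (fun C D => [disjoint supp C & supp D]) s].

Lemma packing_sub E l k k' : k' <= k -> packing E l k -> packing E l k'.
Proof.
move=> hk [s [h1 h2 h3]]; exists (take k' s); split.
- by rewrite size_takel // h1.
- by apply/allP=> C /mem_take; apply: (allP h2).
- move: h3; rewrite -{1}(cat_take_drop k' s) pairwise_cat => /and3P[_ h _]; exact: h.
Qed.

(** This says that the cyclomatic number of [F] is at least [n]. Quantifying over all acyclic
    subsets avoids fixing a spanning forest. *)
Definition far F n := [forall T : chain, (T \subset F) && acyclic T ==> (n <= #|F :\: T|)].

Lemma farP F n : reflect (forall T, T \subset F -> acyclic T -> n <= #|F :\: T|) (far F n).
Proof.
apply: (iffP forallP) => [h T h1 h2|h T]; first by have := h T; rewrite h1 h2.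
by apply/implyP=> /andP[]; apply: h.
Qed.

Lemma acyclic0 : acyclic set0.
Proof. by apply/acyclicP=> D; rewrite subset0 => /eqP. Qed.

Lemma circuit_no_acyclic F e T : e \in F -> T \subset F :\ e -> acyclic T ->
  (forall C, circuit C -> C \subset F -> e \notin C) -> acyclic (e |: T).
Proof.
move=> he hT /acyclicP hac hno; apply/acyclicP=> D hD hb.
case: (boolP (e \in D)) => heD.
  have [C [h1 h2 h3]] := circuit_ex_mem hb heD.
  have : e \notin C; last by rewrite h3.
  apply: hno => //; apply: subset_trans h2 (subset_trans hD _).
  by rewrite subUset sub1set he (subset_trans hT) // subD1set.
apply: hac => //; apply/subsetP=> f hf; move/subsetP: hD => /(_ _ hf).
by rewrite !inE; case: eqP => // hfe; rewrite -hfe hf in heD.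
Qed.

(** Induction on k, inside a minimal far subgraph. Minimality puts every edge on a circuit, so no
    degree is 1, and keeps the cyclomatic number at most (k+1)L, so there are fewer than 2^m branch
    vertices. Deleting the vertices of a circuit with at most 2m + 2 branch vertices lowers the
    cyclomatic number by at most 2m + 3, which is at most L. *)
Lemma far_packing F k m L : (forall x, deg F x <= 3) ->
  m.*2 + 3 <= L -> (k * L).*2 < 2 ^ m -> far F (k * L) -> packing F 0 k.
Proof.
elim: k F => [|k IH] F hdeg hL hm hfar; first by exists [::].
have [F' hF' hsub] := minset_exists (P := fun F => far F (k.+1 * L)) hfar.
have far' := minsetp hF'.
have hmin e : e \in F' -> exists T, [/\ T \subset F' :\ e, acyclic T & #|(F' :\ e) :\: T| < k.+1
  * L].
  move=> he; have : ~~ far (F' :\ e) (k.+1 * L).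
    apply/negP=> h; case/minsetP: hF' => _ /(_ _ h (subD1set _ _)) h'.
    by move: he; rewrite -h' !inE eqxx.
  rewrite negb_forall => /existsP[T]; rewrite negb_imply -ltnNge => /andP[/andP[t1 t2] t3].
  by exists T.
have hn0 : F' != set0.
  apply/eqP=> h; have := farP _ _ far' set0 (sub0set _) acyclic0.
  by rewrite h setD0 cards0 mulSn; lia.
have hcirc e : e \in F' -> exists C, [/\ circuit C, C \subset F' & e \in C].
  move=> he.
  case: (boolP [exists C : chain, [&& circuit C, C \subset F' & e \in C]]).
    by case/existsP=> C /and3P[c1 c2 c3]; exists C.
  (* An edge on no circuit could join the forest of [F' :\ e], leaving too few edges of [F'] outside
     it. *)
  rewrite negb_exists => /forallP hno; have [T [t1 t2 t3]] := hmin e he.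
  have t4 : acyclic (e |: T).
    apply: (circuit_no_acyclic he) => // C c1 c2; have := hno C; by rewrite c1 c2.
  have t5 : e |: T \subset F' by rewrite subUset sub1set he (subset_trans t1) // subD1set.
  have := farP _ _ far' _ t5 t4; rewrite (_ : F' :\: (e |: T) = (F' :\ e) :\: T); first by lia.
  by rewrite setDDl.
have deg' x : deg F' x <= 3 by apply: leq_trans (hdeg x); apply: degS.
have deg2 x : x \in supp F' -> 2 <= deg F' x.
  case/suppP=> e he hx; have [C [c1 c2 c3]] := hcirc e he.
  by rewrite -(circuit_deg ends2 c1 (mem_supp c3 hx)) degS.
have deg1' x : deg F' x != 1.
  by case: (boolP (x \in supp F')) => [/deg2|/deg0 -> //]; case: (deg F' x) => [|[]].
have hbr : #|branch F'| < 2 ^ m.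
  case/set0Pn: (hn0) => e he; have [T [t1 t2 t3]] := hmin e he.
  have tF : T \subset F' by apply: subset_trans t1 (subD1set _ _).
  have c1 : #|F' :\: T| <= k.+1 * L.
    apply: leq_trans t3; rewrite (cardsD1 e) !inE he andbT.
    rewrite (_ : _ :\: T :\ e = (F' :\ e) :\: T); last by rewrite !setDDl setUC.
    by case: (e \in T); rewrite ?add0n ?add1n // ltnW.
  by apply: leq_ltn_trans (card_branch deg1' tF t2) (leq_ltn_trans _ hm); rewrite leq_double.
have [C [c1 c2 c3]] := short_circuit hn0 deg1' deg' hbr.
pose F1 := [set e in F' | [disjoint ends e & supp C]].
have F1F' : F1 \subset F' by apply/subsetP=> e; rewrite inE => /andP[].
have dis : [disjoint F1 & C].
  apply/pred0P=> e /=; rewrite inE; apply/negP=> /andP[/andP[_ h] heC].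
  have : 0 < #|ends e| by rewrite ends2.
  by case/card_gt0P=> x hx; have := disjointFr h hx; rewrite (mem_supp heC hx).
have far1 : far F1 (k * L).
  apply/farP=> T hT acT; have [c hc] := set0Pn _ (circuit_n0 c1).
  (* A forest of [F1] together with [C] minus one edge is a forest of [F']. Outside it lie only
     [F1 :\: T], the edge [c] and the set [X] of edges off [C] that touch [C]. *)
  have acT' : acyclic (T :|: (C :\ c)).
    apply/acyclicP=> D hD hb.
    have star_in x : x \in supp C -> deg (D :&: C) x = deg D x.
      move=> hx; rewrite /deg; congr #|pred_of_set _|; apply/setP=> e; rewrite !inE -andbA.
      case: (boolP (e \in D)) => //= he; case: (boolP (x \in ends e)) => hxe;
        rewrite ?andbF // andbT.
      move/subsetP: hD => /(_ _ he); rewrite !inE => /orP[/(subsetP hT)|/andP[]//].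
      by rewrite inE => /andP[_ h]; have := disjointFr h hxe; rewrite hx.
    have h0 : D :&: C = set0.
      case: (circuit_min c1 (subsetIr D C)) => //.
        apply/setP=> x; rewrite in_bd inE; case: (boolP (x \in supp C)) => hx.
          by rewrite star_in // -in_bd hb inE.
        by rewrite deg0 //; apply: contra hx; apply/subsetP; apply: suppS; apply: subsetIr.
      move=> h; have : c \in D :&: C by rewrite h.
      rewrite inE hc andbT => /(subsetP hD); rewrite !inE eqxx /= orbF.
      by move=> /(subsetP hT) h'; have := disjointFr dis h'; rewrite hc.
    apply: (acyclicP _ _ acT) => //; apply/subsetP=> e he.
    move/subsetP: hD => /(_ _ he); rewrite !inE => /orP[//|/andP[_ heC]].
    by have : e \in D :&: C; [rewrite inE he | rewrite h0 inE].
  have sub' : T :|: (C :\ c) \subset F'.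
    by rewrite subUset (subset_trans hT) // (subset_trans (subD1set _ _)).
  have hf := farP _ _ far' _ sub' acT'.
  pose X := (F' :\: F1) :\: C.
  (* Two of the at most three edges at a vertex of [C] lie on [C], so each edge of [X] can be
     charged to a branch vertex on [C], and each of these is charged at most once. *)
  have cX : #|X| <= m.*2.+2.
    apply: leq_trans c3.
    have a1 : #|X| <= \sum_(x in supp C) deg X x.
      rewrite sum_deg -sum1_card; apply: leq_sum=> e.
      rewrite in_setD in_setD inE => /and3P[_ h he]; rewrite he /= in h.
      by rewrite card_gt0 setI_eq0.
    apply: leq_trans a1 _; rewrite -sum1_card big_mkcond [X in _ <= X]big_mkcond /=.
    apply: leq_sum=> x _; rewrite in_setI; case: (boolP (x \in supp C)) => hx;
      last by rewrite andbF.
    have a2 : deg X x + 2 <= deg F' x.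
      rewrite -(circuit_deg ends2 c1 hx) -deg_disjU; last first.
        by apply/pred0P=> e /=; rewrite !inE; case: (e \in C); rewrite ?andbF.
      apply: degS; rewrite subUset c2 andbT; apply/subsetP=> e; rewrite !inE => /and3P[_ _]; exact.
    have := deg' x; rewrite andbT inE; clear -a2; case: eqP; lia.
  have : #|F' :\: (T :|: (C :\ c))| <= #|F1 :\: T| + #|X| + 1.
    rewrite -(cards1 c); apply: leq_trans (leq_add (leq_card_setU _ _) (leqnn _)).
    apply: leq_trans (leq_card_setU _ _); apply: subset_leq_card; apply/subsetP=> e.
    rewrite !inE; case: (e == c); case: (e \in C); case: (e \in T); case: (e \in F') => //=;
      by case: [disjoint _ & _].
  move: hf; rewrite mulSn; clear -cX hL; lia.
have deg1F x : deg F1 x <= 3 by apply: leq_trans (deg' x); apply: degS.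
have [|s [s1 s2 s3]] := IH F1 deg1F hL _ far1.
  by apply: leq_ltn_trans hm; rewrite leq_double leq_mul2r leqnSn orbT.
exists (C :: s); rewrite /= s1 c1 (subset_trans c2) // s3 andbT; split=> //.
  by apply: sub_all s2 => D /and3P[-> h _]; rewrite (subset_trans h (subset_trans F1F' hsub)).
apply/allP=> D /(allP s2) /and3P[_ h _]; apply/pred0P=> x /=; apply/negP=> /andP[hx].
case/suppP=> e /(subsetP h); rewrite inE => /andP[_ h'] hxe.
by have := disjointFr h' hxe; rewrite hx.
Qed.

End Simonovits.

(** * Graphs without circuits of medium length *)

Section Key.
Variables (V W : finType) (ends : W -> {set V}).
Hypothesis ends2 : forall e, #|ends e| = 2.
Local Notation chain := {set W}.
Local Notation bd := (bd ends).
Local Notation deg := (deg ends).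
Local Notation supp := (supp ends).
Local Notation circuit := (circuit ends).
Local Notation acyclic := (acyclic ends).
Local Notation minpath := (minpath ends).
Local Notation branch := (branch ends).
Local Notation null := (null ends).
Implicit Types (A B C D E F P Q T Z : chain) (x y z a b : V) (e f g : W).

Lemma symd_inj (T : finType) (A B C : {set T}) : symd A B = symd A C -> B = C.
Proof. by move=> h; rewrite -(symdK A B) h symdK. Qed.

(** The two parts of an even chain have equal boundaries, which therefore lie in both supports. *)
Lemma bd_part A B D : [disjoint A & B] -> D \subset A :|: B -> bd D = set0 ->
  bd (D :&: B) \subset supp A :&: supp B.
Proof.
move=> hAB hD hb.
have hx x : deg D x = deg (D :&: A) x + deg (D :&: B) x.
  rewrite -deg_disjU; first by rewrite -setIUr (setIidPl hD).
  by apply: disjointW hAB; apply: subsetIr.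
apply/subsetP=> x; rewrite in_bd => ho; rewrite in_setI; apply/andP; split.
  apply: contraT => hA; have := in_bd ends D x; rewrite hb in_set0 hx oddD ho.
  by rewrite deg0 //; apply: contra hA; apply/subsetP; apply: suppS; apply: subsetIr.
apply: contraT => hB; move: ho; rewrite deg0 //.
by apply: contra hB; apply/subsetP; apply: suppS; apply: subsetIr.
Qed.

Lemma bd_sub2 A a b : a != b -> bd A \subset [set a;
  b] -> bd A = set0 \/ bd A = symd [set a] [set b].
Proof.
move=> hab h; rewrite symd_pair //; case: (boolP (a \in bd A)) => ha; last first.
  left; apply/setP=> x; rewrite in_set0; apply/negbTE/negP=> hx.
  have hA : bd A = [set b].
    apply/setP=> y; rewrite in_set1; apply/idP/eqP => [hy|->].
      by move/subsetP: h => /(_ _ hy); rewrite !inE => /orP[]/eqP // hya; rewrite -hya hy in ha.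
    by have := subsetP h _ hx; rewrite in_set2 => /orP[]/eqP hya;
      [rewrite -hya hx in ha | rewrite -hya].
  by have := odd_bd ends2 A; rewrite hA cards1.
right; apply/eqP; rewrite eqEsubset h subUset !sub1set ha /=; apply: contraT => hb.
have hA : bd A = [set a].
  apply/setP=> y; rewrite in_set1; apply/idP/eqP => [hy|-> //].
  by move/subsetP: h => /(_ _ hy); rewrite !inE => /orP[]/eqP // hya; rewrite -hya hy in hb.
by have := odd_bd ends2 A; rewrite hA cards1.
Qed.

Lemma disj_supp A B : [disjoint supp A & supp B] -> [disjoint A & B].
Proof.
move=> h; apply/pred0P=> e /=; apply/negP=> /andP[h1 h2].
have : 0 < #|ends e| by rewrite ends2.
by case/card_gt0P=> x hx; have := disjointFr h (mem_supp h1 hx); rewrite (mem_supp h2 hx).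
Qed.

Lemma disj_supp1 A B z : supp A :&: supp B \subset [set z] -> [disjoint A & B].
Proof.
move=> h; apply/pred0P=> e /=; apply/negP=> /andP[h1 h2].
have : ends e \subset [set z].
  by apply: subset_trans h; apply/subsetP=> x hx; rewrite inE !(mem_supp _ hx).
by move/subset_leq_card; rewrite ends2 cards1.
Qed.

Lemma acyclic_minpath a b P : acyclic P -> bd P = symd [set a] [set b] -> minpath a b P.
Proof.
move=> /acyclicP hP hb; apply/minsetP; split=> [|B /eqP hB hs]; first exact/eqP.
by apply: symd_eq0; apply: hP; [apply: symd_sub | rewrite bd_symd hB hb symdd].
Qed.

Variables (E : chain) (l : nat).
Hypothesis E_medium : no_medium ends E l.

Definition linked e f := [exists C : chain, [&& circuit C, C \subset E, #|C| < l, e \in C & f \in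
  C]].

Lemma linkedC e f : linked e f = linked f e.
Proof. by apply: eq_existsb => C; rewrite (andbC (e \in C)). Qed.

(** Circuit elimination gives a circuit through [e] and [g] in the union of two short circuits; it
    has fewer than 2l edges, and the gap makes it short. *)
Lemma linked_trans f e g : linked e f -> linked f g -> linked e g.
Proof.
move=> /existsP[C /and5P[c1 c2 c3 c4 c5]] /existsP[D /and5P[d1 d2 d3 d4 d5]].
have [|K [k1 k2 k3 k4]] := circuit_trans c1 d1 c4 d5.
  by apply/negP=> h; have := disjointFr h c5; rewrite d4.
have kE : K \subset E by apply: subset_trans k2 _; rewrite subUset c2.
apply/existsP; exists K; rewrite k1 kE k3 k4 !andbT /= ltnNge.
apply/negP=> /(E_medium k1 kE); apply/negP; rewrite -ltnNge -addnn.
apply: leq_ltn_trans (subset_leq_card k2) (leq_ltn_trans (leq_card_setU _ _) _).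
by rewrite -addSn leq_add // ltnW.
Qed.

Lemma long_not_null Z : circuit Z -> l <= #|Z| -> ~ null E l Z.
Proof. by move=> hZ hl /(null_circuit_short E_medium hZ); rewrite ltnNge hl. Qed.

(** * Maximal frames, their ears and the circuits hanging off them *)

Section Frame.
Variable F : chain.

Definition frame F := [&& F \subset E, [forall x, deg F x \in [:: 0; 2; 3]] &
  [forall C : chain, circuit C && (C \subset F) ==> (l <= #|C|)]].

Hypothesis F_max : maxset frame F.

Lemma frame_sub : F \subset E. Proof. by case/and3P: (maxsetp F_max). Qed.
Lemma frame_deg x : deg F x \in [:: 0; 2; 3].
Proof. by case/and3P: (maxsetp F_max) => _ /forallP. Qed.
Lemma frame_long C : circuit C -> C \subset F -> l <= #|C|.
Proof. by case/and3P: (maxsetp F_max) => _ _ /forallP/(_ C) + h1 h2; rewrite h1 h2. Qed.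

Lemma frame_ext A : A \subset E -> [disjoint F & A] -> A != set0 ->
  (forall x, deg F x + deg A x \in [:: 0; 2; 3]) ->
  exists C, [/\ circuit C, C \subset F :|: A, #|C| < l & C :&: A != set0].
Proof.
move=> hA hFA hn hdeg.
have : ~~ frame (F :|: A).
  apply/negP=> h; case/maxsetP: F_max => _ /(_ _ h (subsetUl _ _)) hF.
  case/negP: hn; rewrite -subset0; move: hFA; rewrite -setI_eq0 => /eqP <-.
  by rewrite subsetI subxx andbT -hF subsetUr.
rewrite /frame subUset frame_sub hA /= negb_and => /orP[/forallP[]|].
  by move=> x; rewrite deg_disjU.
rewrite negb_forall => /existsP[C]; rewrite negb_imply -ltnNge => /andP[/andP[h1 h2] h3].
exists C; split=> //; apply/negP=> /eqP h4.
have : C \subset F.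
  apply/subsetP=> e he; move/subsetP: h2 => /(_ _ he); rewrite inE => /orP[//|heA].
  by have : e \in C :&: A; [rewrite inE he | rewrite h4 inE].
by move/(frame_long h1); rewrite leqNgt h3.
Qed.

Lemma null_frame A : null E l A -> A \subset F -> A = set0.
Proof.
move=> hA hAF; apply/eqP; apply: contraT => hn.
have [C [h1 h2 h3]] := null_short E_medium hA hn.
by have := frame_long h1 (subset_trans h2 hAF); rewrite leqNgt h3.
Qed.

(** Otherwise [Z] could be added to the frame: a short circuit created in this way meets [Z] in an
    even set, hence contains all of the long circuit [Z]. *)
Lemma long_meets Z : circuit Z -> Z \subset E -> l <= #|Z| -> ~~ [disjoint supp F & supp Z].
Proof.
move=> hZ hZE hl; apply/negP=> hd.
have hdis := disj_supp hd.
have [x|C [h1 h2 h3 h4]] := frame_ext hZE hdis (circuit_n0 hZ).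
  case: (boolP (x \in supp Z)) => hx; last by rewrite (deg0 hx) addn0 frame_deg.
  by rewrite (circuit_deg ends2 hZ hx) deg0 ?inE // (disjointFl hd).
have hb0 : bd (C :&: Z) = set0.
  apply/eqP; rewrite -subset0; move: hd; rewrite -setI_eq0 => /eqP <-.
  exact: bd_part hdis h2 (circuit_bd h1).
case: (circuit_min hZ (subsetIr C Z) hb0) => h.
- by rewrite h eqxx in h4.
- by move: (subset_leq_card (subsetIl C Z)); rewrite h leqNgt (leq_trans h3).
Qed.

(** The ends are distinct and of degree 2 in [F], so that adding the ear raises them to degree 3 and
    keeps all degrees admissible for a frame. *)
Definition ear a b P := [/\ a != b, minpath a b P, P \subset E, [disjoint F & P] &
  [/\ a \in supp F, a \notin branch F, b \in supp F, b \notin branch F &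
      supp F :&: supp P \subset [set a; b]]].

Lemma frame_deg2 a : a \in supp F -> a \notin branch F -> deg F a = 2.
Proof.
rewrite -deg_supp inE; have := frame_deg a; rewrite !inE.
by case/or3P=> /eqP->.
Qed.

(** By maximality, adding the ear creates a short circuit that uses [P]. The boundary of its part in
    [P] lies in the set of the two ends, so this part is all of [P]; the remainder is [Q]. *)
Lemma ear_close a b P : ear a b P ->
  exists Q, [/\ Q \subset F, circuit (P :|: Q) & #|P :|: Q| < l].
Proof.
case=> hab hP hPE hFP [aF aB bF bB hs].
have [d1 d2 d3 [p [_ _ _ _ hp]]] := minpath_struct ends2 hab hP.
have hn : P != set0.
  by apply/negP=> /eqP h0; move: d1; rewrite h0 deg_set0.
have [x|C [h1 h2 h3 h4]] := frame_ext hPE hFP hn.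
  case: (eqVneq x a) => [->|hxa]; first by rewrite d1 frame_deg2.
  case: (eqVneq x b) => [->|hxb]; first by rewrite d2 frame_deg2.
  case: (boolP (x \in supp P)) => hx; last by rewrite (deg0 hx) addn0 frame_deg.
  rewrite d3 // deg0 //; apply/negP=> hxF.
  by move/subsetP: hs => /(_ x); rewrite !inE hxF hx (negPf hxa) (negPf hxb) => /(_ isT).
have hCP : C :&: P = P.
  case: (bd_sub2 hab (subset_trans (bd_part hFP h2 (circuit_bd h1)) hs)) => hb.
    have h0 := acyclicP _ _ (minpath_acyclic hP) _ (subsetIr C P) hb.
    by rewrite h0 eqxx in h4.
  exact: minpath_min hP (subsetIr C P) hb.
exists (C :&: F); split; first exact: subsetIr.
  by rewrite -{1}hCP -setIUr setUC (setIidPl h2).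
by rewrite -{1}hCP -setIUr setUC (setIidPl h2).
Qed.

(** Both ears close up through the same chain of [F]: the sum of the closing chains is even with
    fewer than 2l edges, hence null, and [F] carries no nonempty null chain. So [P] + [P'] is the
    sum of the two short circuits. *)
Lemma ear_null a b P P' : ear a b P -> ear a b P' -> null E l (symd P P').
Proof.
move=> he he'.
have [Q [q1 q2 q3]] := ear_close he; have [Q' [q1' q2' q3']] := ear_close he'.
case: he => _ hP hPE hd _; case: he' => _ hP' hPE' hd' _.
have hdis (A B : chain) : [disjoint F & A] -> B \subset F -> A :|: B = symd A B.
  move=> h1 h2; rewrite symd_disj //; apply: disjointWr h2 _; by rewrite disjoint_sym.
rewrite (hdis P Q hd q1) in q2 q3; rewrite (hdis P' Q' hd' q1') in q2' q3'.
have sub (A B : chain) : A \subset E -> B \subset F -> symd A B \subset E.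
  by move=> h1 h2; apply: symd_sub => //; apply: subset_trans h2 frame_sub.
have n1 := null_circuit q2 (sub _ _ hPE q1) q3.
have n2 := null_circuit q2' (sub _ _ hPE' q1') q3'.
have bdQ (A B : chain) : circuit (symd A B) -> bd A = bd B.
  by move=> h; apply: symd_eq0; rewrite -bd_symd (circuit_bd h).
have hQ : symd Q Q' = set0.
  have hQF : symd Q Q' \subset F by apply: symd_sub.
  apply: null_frame => //; apply: null_small => //.
  - exact: subset_trans hQF frame_sub.
  - by rewrite bd_symd -(bdQ _ _ q2) -(bdQ _ _ q2') (minpath_bd hP) (minpath_bd hP') symdd.
  - have le (A B : chain) : [disjoint F & A] -> B \subset F -> #|B| <= #|symd A B|.
      by move=> h1 h2; rewrite -hdis // subset_leq_card // subsetUr.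
    apply: leq_ltn_trans (card_symd_le _ _) _; rewrite -addnn -addSn; apply: leq_add.
      exact: leq_ltn_trans (le _ _ hd q1) q3.
    by apply: ltnW; apply: leq_ltn_trans (le _ _ hd' q1') q3'.
have -> : symd P P' = symd (symd P Q) (symd P' Q').
  by rewrite (symd_eq0 hQ) -symdA (symdC P') symdK.
exact: null_symd.
Qed.

Definition balloon z Z := [&& circuit Z, Z \subset E, l <= #|Z|, z \notin branch F &
  supp F :&: supp Z == [set z]].

(** If the circuits met, a path in [Z'] from [z'] to its first vertex [w] on [Z] could be continued
    to [z] along either of the two arcs of [Z]. These are two ears with the same ends whose sum is
    [Z], so the long circuit [Z] would be null. *)
Lemma balloon_disjoint z z' Z Z' : balloon z Z -> balloon z' Z' -> z != z' ->
  [disjoint supp Z & supp Z'].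
Proof.
case/and5P=> hZ hZE hl hzB /eqP hzF /and5P[hZ' hZE' _ hzB' /eqP hzF'] hzz'.
have [zF zZ] : z \in supp F /\ z \in supp Z.
  by apply/andP; rewrite -in_setI hzF inE.
have [zF' zZ'] : z' \in supp F /\ z' \in supp Z'.
  by apply/andP; rewrite -in_setI hzF' inE.
have zZ'n : z' \notin supp Z.
  by apply/negP=> h; have : z' \in supp F :&: supp Z;
    [rewrite inE zF' | rewrite hzF inE eq_sym (negPf hzz')].
have z'Zn : z \notin supp Z'.
  by apply/negP=> h; have : z \in supp F :&: supp Z';
    [rewrite inE zF | rewrite hzF' inE (negPf hzz')].
apply: contraT => /pred0Pn[w0 /= /andP[w1 w2]].
(* Minimality of [B] among all chains from [z'] to any vertex of [Z] ensures that it touches [Z]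
   only at its end. *)
pose meets (B : chain) := (B \subset Z') &&
  [exists w, (w \in supp Z) && (bd B == symd [set z'] [set w])].
have [B0 b1 b2] := circuit_connected ends2 hZ' zZ' w2.
have [|B hB _] := @minset_exists _ meets B0.
  by rewrite /meets b1; apply/existsP; exists w0; rewrite w1 b2 eqxx.
have /andP[BZ' /existsP[w /andP[wZ /eqP hb]]] := minsetp hB.
have Bmin (B' : chain) v : B' \subset B -> v \in supp Z -> bd B' = symd [set z'] [set v] -> B' = B.
  move=> h1 h2 h3; case/minsetP: hB => _; apply=> //.
  by rewrite /meets (subset_trans h1 BZ'); apply/existsP; exists v; rewrite h2 h3 eqxx.
have hz'w : z' != w by apply: contraNneq zZ'n => ->.
have pB : minpath z' w B.
  by apply/minsetP; split=> [|B' /eqP h1 h2]; [apply/eqP | apply: Bmin h2 wZ h1].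
have hBZ : supp B :&: supp Z \subset [set w].
  apply/subsetP=> v; rewrite in_setI in_set1 => /andP[vB vZ].
  have [B' h1 h2] := minpath_connected ends2 hz'w pB vB.
  by have h := Bmin _ _ h1 vZ h2; move: h2; rewrite h hb => /symd_inj/set1_inj->.
have wZ' : w \in supp Z'.
  apply: (subsetP (suppS _ BZ')); apply: (subsetP (bd_supp ends B)).
  by rewrite hb in_symd !in_set1 eqxx eq_sym (negPf hz'w).
have hwz : w != z by apply: contraNneq z'Zn => <-.
have [B1 b11 b12] := circuit_connected ends2 hZ wZ zZ.
pose B2 := symd Z B1.
have b21 : B2 \subset Z by apply: symd_sub.
have b22 : bd B2 = symd [set w] [set z] by rewrite bd_symd (circuit_bd hZ) sym0d.
have isear A : A \subset Z -> bd A = symd [set w] [set z] -> ear z' z (B :|: A).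
  move=> hA hbA.
  have sBA : supp B :&: supp A \subset [set w].
    by apply: subset_trans hBZ; apply: setIS; apply: suppS.
  have dBA : [disjoint B & A] := disj_supp1 sBA.
  have hAZ : A <> Z.
    move=> h; move: hbA; rewrite h (circuit_bd hZ) => /esym /symd_eq0 /set1_inj h'.
    by rewrite h' eqxx in hwz.
  have acA : acyclic (B :|: A).
    apply/acyclicP=> D hD hbD.
    have h1 : bd (D :&: A) = set0.
      have h := subset_trans (bd_part dBA hD hbD) sBA.
      case: (bd_sub2 hwz (subset_trans h _)) => //; first by rewrite sub1set !inE eqxx.
      move=> h'; have : z \in bd (D :&: A) by rewrite h' in_symd !in_set1 eqxx eq_sym (negPf hwz).
      by move/(subsetP h); rewrite in_set1 eq_sym (negPf hwz).
    have h2 : D :&: A = set0.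
      case: (circuit_min hZ (subset_trans (subsetIr D A) hA) h1) => // h.
      by case: hAZ; apply/eqP; rewrite eqEsubset hA -h subsetIr.
    have h3 : D \subset B.
      apply/subsetP=> e he; move/subsetP: hD => /(_ _ he); rewrite inE => /orP[//|heA].
      by have : e \in D :&: A; [rewrite inE he | rewrite h2 inE].
    exact: acyclicP _ _ (minpath_acyclic pB) _ h3 hbD.
  split; first by rewrite eq_sym.
  - by apply: acyclic_minpath => //; rewrite -symd_disj // bd_symd hb hbA symd_tri.
  - by rewrite subUset (subset_trans BZ') // (subset_trans hA).
  - have h1 : [disjoint F & Z'] by apply: (@disj_supp1 _ _ z'); rewrite hzF'.
    have h2 : [disjoint F & Z] by apply: (@disj_supp1 _ _ z); rewrite hzF.
    by rewrite -setI_eq0 setIUr setU_eq0 !setI_eq0 (disjointWr BZ' h1) (disjointWr hA h2).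
  - split=> //; rewrite suppU setIUr; apply: setUSS.
      by rewrite -hzF'; apply: setIS; apply: suppS.
    by rewrite -hzF; apply: setIS; apply: suppS.
have := ear_null (isear _ b11 b12) (isear _ b21 b22).
have dis A : A \subset Z -> B :|: A = symd B A.
  move=> hA; rewrite symd_disj //; apply: (@disj_supp1 _ _ w).
  by apply: subset_trans hBZ; apply: setIS; apply: suppS.
rewrite (dis _ b11) (dis _ b21) (symdC B B1) -symdA symdK symdC -symdA symdd symd0.
by move/(long_not_null hZ hl).
Qed.

(* If [x] is deleted, no remaining ear is closed up through [f], so [F] is cut at [f]. *)
Definition free_at x f := [&& f \in F, x \in ends f &
  [forall g in F, (g != f) && (x \in ends g) ==> ~~ linked f g]].
Definition free f := [exists x, free_at x f].

(** Suppose no edge is free: each edge of [C] is linked at both ends to another edge of [F]. With at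
    most three edges at a vertex, transitivity links consecutive edges of [C], and so all its edges
    to one another. Then any two vertices of [C] are joined inside a short circuit, and coning from
    one vertex makes the long circuit [C] null. *)
Lemma circuit_free C : circuit C -> C \subset F -> exists2 f, f \in C & free f.
Proof.
move=> hC hCF; case: (boolP [exists f in C, free f]) => [/exists_inP//|].
rewrite negb_exists_in => /forall_inP hno.
have hlink x e : e \in C -> x \in ends e ->
    exists g, [/\ g \in F, g != e, x \in ends g & linked e g].
  move=> he hx; have := hno e he; rewrite negb_exists => /forallP/(_ x).
  rewrite /free_at (subsetP hCF _ he) hx /= negb_forall_in => /exists_inP[g h1].
  by rewrite negb_imply negbK => /andP[/andP[h2 h3] h4]; exists g.
have adjacent x e f : e \in C -> f \in C -> x \in ends e -> x \in ends f -> e != f -> linked e f.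
  move=> he hf hxe hxf hef.
  have [g [g1 g2 g3 g4]] := hlink x e he hxe; have [h [h1 h2 h3 h4]] := hlink x f hf hxf.
  case: (eqVneq g f) => [<- //|hgf]; case: (eqVneq h e) => [<-|hhe]; first by rewrite linkedC.
  case: (eqVneq g h) => [hgh|hgh]; first by rewrite (linked_trans g4) // hgh linkedC.
  have : 4 <= #|star ends F x|.
    apply: leq_trans (_ : #|e |: (f |: (g |: [set h]))| <= _).
      rewrite !cardsU1 !inE !negb_or cards1 hef hgh.
      by rewrite (eq_sym e g) g2 (eq_sym e h) hhe (eq_sym f g) hgf (eq_sym f h) h2.
    apply: subset_leq_card; rewrite !subUset !sub1set !inE.
    by rewrite (subsetP hCF _ he) (subsetP hCF _ hf) hxe hxf g1 g3 h1 h3.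
  by have := frame_deg x; rewrite !inE -/(deg F x) => /or3P[]/eqP->.
have [e0 he0] := set0Pn _ (circuit_n0 hC).
have link0 : linked e0 e0.
  have : 0 < #|ends e0| by rewrite ends2.
  case/card_gt0P=> x hx; have [g [_ _ _ hg]] := hlink x e0 he0 hx.
  by apply: (linked_trans hg); rewrite linkedC.
(* At each vertex both edges of [C] belong to [S] or neither does, so [S] is even and equals [C]. *)
pose S := [set e in C | linked e0 e].
have SC : S \subset C by apply/subsetP=> e; rewrite inE => /andP[].
have bdS : bd S = set0.
  apply/setP=> x; rewrite in_bd inE; case: (boolP (x \in supp C)) => hx; last first.
    by rewrite deg0 //; apply: contra hx; apply/subsetP; apply: suppS.
  have /eqP/cards2P[e [f [hef hs]]] := circuit_deg ends2 hC hx.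
  have : e \in star ends C x by rewrite hs !inE eqxx.
  have : f \in star ends C x by rewrite hs !inE eqxx orbT.
  rewrite !inE => /andP[hf hxf] /andP[he hxe].
  have hl : linked e0 e = linked e0 f.
    have h := adjacent x e f he hf hxe hxf hef.
    by apply/idP/idP=> h'; [exact: linked_trans h' h | apply: (linked_trans h'); rewrite linkedC].
  have starS : star ends S x = if linked e0 e then star ends C x else set0.
    apply/setP=> g; rewrite [in LHS]inE in_set -andbA.
    have hg : (g \in C) && (x \in ends g) = (g \in [set e; f]) by rewrite -hs inE.
    rewrite andbCA [_ && (x \in _)]hg.
    case: (boolP (linked e0 e)) => h; rewrite ?hs ?in_set0 !inE.
      by case: eqP => [->|_]; rewrite ?h //; case: eqP => [->|]; rewrite ?andbF // -hl h.
    by case: eqP => [->|_]; rewrite ?(negPf h) //; case: eqP => [->|];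
      rewrite ?andbF // -hl (negPf h).
  by rewrite /deg starS; case: (linked e0 e); rewrite ?hs ?cards2 ?hef ?cards0.
have S_all : S = C.
  case: (circuit_min hC SC bdS) => // h.
  by have : e0 \in S; [rewrite inE he0 | rewrite h inE].
have : 0 < #|ends e0| by rewrite ends2.
case/card_gt0P=> a ha.
(* [B x] runs inside a short circuit through [e0] and an edge at [x]. Two such chains and one edge
   have fewer than 2l edges together, which is what [null_small] asks for. *)
have hB x : exists B : chain, x \in supp C ->
    [/\ B \subset E, #|B| < l & bd B = symd [set a] [set x]].
  case: (boolP (x \in supp C)) => [/suppP[e he hx]|]; last by exists set0.
  have : e \in S by rewrite S_all.
  rewrite inE he => /existsP[D /and5P[d1 d2 d3 d4 d5]].
  have [B b1 b2] := circuit_connected ends2 d1 (mem_supp d4 ha) (mem_supp d5 hx).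
  exists B => _; split=> //; first exact: subset_trans d2.
  exact: leq_ltn_trans (subset_leq_card b1) d3.
have [B hBx] := fin_all_exists hB.
case: (@long_not_null C hC (frame_long hC hCF)).
rewrite -(sum_cone B (circuit_bd hC)); apply: null_big => e he.
have /eqP/cards2P[x [y [hxy hee]]] := ends2 e.
have hx : x \in ends e by rewrite hee !inE eqxx.
have hy : y \in ends e by rewrite hee !inE eqxx orbT.
have [x1 x2 x3] := hBx x (mem_supp he hx); have [y1 y2 y3] := hBx y (mem_supp he hy).
rewrite hee big_setU1 ?big_set1 ?in_set1 //=; apply: null_small => //.
- by rewrite !symd_sub // sub1set (subsetP frame_sub) // (subsetP hCF).
- by rewrite !bd_symd x3 y3 (bd1_pair ends2 hx hy hxy) (symdC [set a]) symd_tri symdd.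
- apply: leq_ltn_trans (card_symd_le _ _) _; rewrite cards1 add1n -addnn.
  by apply: leq_trans (leq_add x2 y2); rewrite addSn addnS !ltnS card_symd_le.
Qed.

(** * Long circuits that avoid the deleted vertices *)

Section Hit.
Variables (Z Y : chain) (h : W -> V).
Hypothesis Z_circuit : circuit Z.
Hypothesis Z_sub : Z \subset E.
Hypothesis Z_long : l <= #|Z|.
Hypothesis Z_branch : [disjoint supp Z & branch F].
Hypothesis Z_balloon : forall z, z \in supp Z -> ~~ balloon z Z.
Hypothesis Y_free : forall f, f \in Y -> free_at (h f) f /\ h f \notin supp Z.

(** If [f] were in [Q] and in [Y], the short circuit [P :|: Q] would have a second edge at [h f].
    This edge is not in [P], because [Z] avoids [h f], so it is an edge of [F] linked to [f],
    against freeness. *)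
Lemma ear_avoid a b P Q : ear a b P -> P \subset Z -> Q \subset F -> circuit (P :|: Q) ->
  #|P :|: Q| < l -> [disjoint Q & Y].
Proof.
case=> _ _ _ hd _ hPZ hQ hc hl; apply/pred0P=> f /=; apply/negP=> /andP[fQ fY].
have [/and3P[fF hf /forall_inP hfree] hZ] := Y_free fY.
have hfc : f \in P :|: Q by rewrite inE fQ orbT.
have := circuit_deg ends2 hc (mem_supp hfc hf).
rewrite /deg (cardsD1 f) inE hfc hf add1n => -[h1].
have /card_gt0P[g] : 0 < #|star ends (P :|: Q) (h f) :\ f| by rewrite h1.
rewrite !inE => /and3P[hgf hg hgx].
have gF : g \in F.
  case/orP: hg => [hgP|/(subsetP hQ)//].
  by case/negP: hZ; apply: mem_supp (subsetP hPZ _ hgP) hgx.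
have := hfree g gF; rewrite hgf hgx /= => /negP[]; apply/existsP; exists (P :|: Q).
rewrite hc hl hfc inE hg /= andbT subUset (subset_trans hPZ) //=.
exact: subset_trans hQ frame_sub.
Qed.

(* Minimal nonempty sets of edges of [Z] outside [F] that are even off [supp F] are ears. *)
Lemma relative_chain A : A \subset Z :\: F -> bd A \subset supp F ->
  exists Q, [/\ Q \subset F, [disjoint Q & Y] & null E l (symd A Q)].
Proof.
elim: {A}_.+1 {-2}A (ltnSn #|A|) => // n IH A hn hA hb.
case: (eqVneq A set0) => [->|hA0].
  by exists set0; rewrite sub0set -setI_eq0 set0I symdd; split=> //; apply: null0.
pose rel (P : chain) := (P != set0) && (bd P \subset supp F).
have [|P hP hPA] := @minset_exists _ rel A; first by rewrite /rel hA0.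
have /andP[hP0 hPb] := minsetp hP.
have Pmin (B : chain) a b : a != b -> B \subset P -> a \in supp F -> b \in supp F ->
    bd B = symd [set a] [set b] -> B = P.
  move=> hab hB ha hb' h'; case/minsetP: hP => _; apply=> //; rewrite /rel h'.
  rewrite symd_pair // subUset !sub1set ha hb' /= andbT; apply: contraNneq hab => h0.
  by move: h'; rewrite h0 bd0 => /esym/symd_eq0/set1_inj->.
have hPZ : P \subset Z by apply: subset_trans hPA (subset_trans hA (subsetDl _ _)).
have hPF : [disjoint F & P].
  rewrite disjoint_sym; apply: disjointWl (subset_trans hPA hA) _.
  by rewrite -setI_eq0 setIDAC setDIl setDv setI0.
have PE := subset_trans hPZ Z_sub.
have notbr x : x \in supp Z -> x \notin branch F by move=> hx; rewrite (disjointFr Z_branch).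
(* An even [P] is all of [Z]. A second vertex of [Z] on [F] would give an arc contradicting the
   minimality of [P], so [Z] would be a balloon. *)
case: (eqVneq (bd P) set0) => [hbP|/set0Pn[a ha]].
  case: (circuit_min Z_circuit hPZ hbP) => hPeq; first by rewrite hPeq eqxx in hP0.
  have /pred0Pn[z /= /andP[zF zZ]] := long_meets Z_circuit Z_sub Z_long.
  case/negP: (Z_balloon zZ); apply/and5P; split=> //; first exact: notbr.
  rewrite eqEsubset sub1set in_setI zF zZ /= andbT; apply/subsetP=> z2; rewrite in_setI in_set1.
  move=> /andP[z2F z2Z]; apply: contraT => hz.
  have [B b1 b2] := circuit_connected ends2 Z_circuit z2Z zZ.
  have hBP : B = P by apply: (Pmin B z2 z); rewrite // hPeq.
  by move: b2; rewrite hBP hbP => /esym/symd_eq0/set1_inj h'; rewrite h' eqxx in hz.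
have aP := subsetP (bd_supp ends P) _ ha.
have aF := subsetP hPb _ ha.
(* Minimality also makes [P] connected; it then joins [a] to any other vertex it has on [F], so only
   [a] and [b] lie there and [P] is an ear. *)
have [D' [U [sub aU hbD inD' con]]] := component ends2 P a.
have eqD : D' = P.
  case/minsetP: hP => _; apply=> //; rewrite /rel hbD (subset_trans (subsetIl _ _) hPb) andbT.
  by case/suppP: aP => e he hae; apply/set0Pn; exists e; apply: inD' hae aU.
have reach x : x \in supp P -> exists2 B : chain, B \subset P & bd B = symd [set a] [set x].
  by rewrite -{1}eqD => hx; have [c1 c2] := con x; have [B b1 b2] := c1 (c2 hx); exists B;
    rewrite // -eqD.
have [b hbP hab] : exists2 b, b \in bd P & a != b.
  case: (boolP [exists b in bd P, a != b]) => [/exists_inP[b]|]; first by exists b.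
  rewrite negb_exists_in => /forall_inP h0; have := odd_bd ends2 P.
  rewrite (_ : bd P = [set a]) ?cards1 //; apply/setP=> x; rewrite in_set1.
  by apply/idP/eqP => [/h0|->//]; rewrite negbK => /eqP.
have bP := subsetP (bd_supp ends P) _ hbP.
have bF := subsetP hPb _ hbP.
have bdP : bd P = symd [set a] [set b].
  by have [B b1 b2] := reach b bP; rewrite -(Pmin B a b).
have hear : ear a b P.
  split=> //.
    by apply/minsetP; split=> [|B /eqP h1 h2]; [apply/eqP | apply: (Pmin B a b)].
  split=> //; try by apply: notbr; apply: (subsetP (suppS _ hPZ)).
  apply/subsetP=> x; rewrite in_setI !in_setU !in_set1 => /andP[xF xP].
  case: (eqVneq x a) => //= hxa; have hax : a != x by rewrite eq_sym.
  have [B b1 b2] := reach x xP; have hB := Pmin B a x hax b1 aF xF b2.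
  by move: b2; rewrite hB bdP => /symd_inj/set1_inj->.
have [Q [q1 q2 q3]] := ear_close hear.
have hPQ : P :|: Q = symd P Q.
  by rewrite symd_disj // disjoint_sym; apply: disjointWl q1 hPF.
have [|||Q' [q1' q2' q3']] := IH (symd A P).
- rewrite symd_setD // cardsD (setIidPr hPA); have := subset_leq_card hPA.
  have : 0 < #|P| by rewrite card_gt0.
  by clear -hn; lia.
- by apply: symd_sub => //; apply: subset_trans hPA hA.
- by rewrite bd_symd symd_sub.
exists (symd Q Q'); split; first exact: symd_sub.
  rewrite -setI_eq0 -subset0; apply/subsetP=> f; rewrite inE in_symd => /andP[hf fY].
  rewrite (disjointFl (ear_avoid hear hPZ q1 q2 q3) fY) in hf.
  by rewrite (disjointFl q2' fY) in hf.
have -> : symd A (symd Q Q') = symd (symd P Q) (symd (symd A P) Q').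
  by rewrite (symdC A P) -(symdA P A) (symdC P Q) -(symdA Q P) symdK (symdA A) (symdC A Q) symdA.
apply: null_symd => //; rewrite -hPQ; apply: null_circuit => //.
by rewrite subUset PE (subset_trans q1 frame_sub).
Qed.

(** Replace the part of [Z] outside [F] by a chain [Q] of [F] that avoids [Y] and differs from it by
    a null chain. Then [Z :&: F] plus [Q] is even and lies in [F :\: Y], so acyclicity would make it
    empty and [Z] null. *)
Lemma frame_hit : Y \subset F -> ~ acyclic (F :\: Y).
Proof.
move=> YF /acyclicP hac.
have hbA : bd (Z :\: F) \subset supp F.
  have : bd (symd (Z :&: F) (Z :\: F)) = set0 by rewrite symd_ID circuit_bd.
  rewrite bd_symd => /symd_eq0 <-; apply: subset_trans (bd_supp _ _) _.
  by apply: suppS; apply: subsetIr.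
have [Q [q1 q2 q3]] := relative_chain (subxx _) hbA.
have h0 : symd (Z :&: F) Q = set0.
  apply: hac.
    apply/subsetP=> f hf; rewrite inE.
    have fF : f \in F by apply: (subsetP _ _ hf); apply: symd_sub => //; apply: subsetIr.
    rewrite fF andbT; apply/negP=> fY; move: hf; rewrite in_symd inE (disjointFl q2 fY) addbF.
    case/andP=> hfZ _; have [/and3P[_ hx _] /negP[]] := Y_free fY.
    exact: mem_supp hfZ hx.
  have := null_bd q3; rewrite bd_symd => /symd_eq0 h1.
  by rewrite bd_symd -h1 -bd_symd symd_ID circuit_bd.
apply: (long_not_null Z_circuit Z_long).
by rewrite -(symd_ID Z F) (symd_eq0 h0) symdC.
Qed.

End Hit.
End Frame.

Definition hits (X : {set V}) := forall Z, circuit Z -> Z \subset E -> l <= #|Z| -> ~~ [disjoint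
  supp Z & X].

(** When neither the frame nor the balloons supply k disjoint circuits, the hitting set has at most
    2kL branch vertices, fewer than k balloon vertices, and one vertex [h f] for each of the at most
    kL edges outside a spanning forest of the frame. *)
Lemma packing_or_hitting k m L : m.*2 + 3 <= L -> (k * L).*2 < 2 ^ m ->
  packing ends E l k \/ exists2 X, hits X & #|X| <= 3 * (k * L) + k.
Proof.
move=> hL hm.
have [|F hF _] := @maxset_exists _ frame set0.
  apply/and3P; split; first exact: sub0set.
    by apply/forallP=> x; rewrite deg_set0.
  apply/forallP=> C; apply/implyP=> /andP[h1]; rewrite subset0 => h2.
  by have := circuit_n0 h1; rewrite h2.
have hFE := frame_sub hF.
have hdeg := frame_deg hF.
case: (boolP (far ends F (k * L))) => hfar.
  left; have [|s [s1 s2 s3]] := far_packing ends2 _ hL hm hfar.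
    by move=> x; have := hdeg x; rewrite !inE => /or3P[]/eqP->.
  exists s; split=> //; apply: sub_all s2 => C /and3P[c1 c2 _].
  by rewrite c1 (subset_trans c2) // (frame_long hF).
move: hfar; rewrite negb_forall => /existsP[T0]; rewrite negb_imply -ltnNge.
move=> /andP[/andP[t1 t2] t3].
(* The edges that are not free contain no circuit, by [circuit_free]. A spanning forest extending
   them leaves only free edges outside, and maximality makes it leave no more of them than [T0]
   does. *)
pose A := [set f in F | ~~ free F f].
have AF : A \subset F by apply/subsetP=> f; rewrite inE => /andP[].
have acA : acyclic A.
  apply/acyclicP=> D hD hb; apply/eqP; apply: contraT => hn.
  have [C c1 c2] := circuit_ex hn hb; have hCA := subset_trans c2 hD.
  have [f f1 f2] := circuit_free hF c1 (subset_trans hCA AF).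
  by have := subsetP hCA _ f1; rewrite inE f2 andbF.
have [T hT AT] := max_acyclic_ex AF acA.
have [TF acT _] := hT.
have cY := max_acyclic_card hT t2.
pose BV := [set z | [exists Z : chain, balloon F z Z]].
have hZ z : exists Z, z \in BV -> balloon F z Z.
  case: (boolP (z \in BV)) => [|_]; last by exists set0.
  by rewrite inE => /existsP[Z]; exists Z.
have [fZ hfZ] := fin_all_exists hZ.
(* Balloons at different vertices are disjoint, so k such vertices already give a packing. *)
case: (leqP k #|BV|) => hk.
  left; apply: packing_sub hk _; exists (map fZ (enum BV)); split.
  - by rewrite size_map -cardE.
  - apply/allP=> _ /mapP[z hz ->]; rewrite mem_enum in hz.
    by case/and5P: (hfZ z hz) => -> -> ->.
  - rewrite pairwise_map; have := enum_uniq BV; rewrite uniq_pairwise.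
    apply: (@sub_in_pairwise _ (mem BV)); last by apply/allP=> z; rewrite mem_enum.
    by move=> z z' hz hz' /= hzz'; apply: balloon_disjoint (hfZ z hz) (hfZ z' hz') hzz'.
right; pose Y := F :\: T.
have hh f : exists x, f \in Y -> free_at F x f.
  case: (boolP (f \in Y)) => [|_].
    rewrite inE => /andP[fT fF]; have : f \notin A by apply: contra fT; apply: (subsetP AT).
    by rewrite inE fF negbK => /existsP[x]; exists x.
  have : 0 < #|ends f| by rewrite ends2.
  by case/card_gt0P=> x _; exists x.
have [h hhf] := fin_all_exists hh.
exists (branch F :|: BV :|: h @: Y).
  move=> Z z1 z2 z3; apply/negP=> hd.
  have notX x : x \in supp Z -> x \notin branch F :|: BV :|: h @: Y.
    by move=> hx; rewrite (disjointFr hd).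
  case: (@frame_hit F hF Z Y h) => //.
  - by apply: disjointWr hd; rewrite -setUA subsetUl.
  - move=> z hz; apply/negP=> hb; have := notX z hz.
    rewrite !in_setU !negb_or => /andP[/andP[_ hn] _]; case/negP: hn.
    by rewrite inE; apply/existsP; exists Z.
  - move=> f fY; split; first exact: hhf.
    by apply/negP=> /notX; rewrite in_setU negb_or imset_f // andbF.
  - exact: subsetDl.
  - by rewrite setDDr setDv set0U (setIidPr TF).
have hbr : #|branch F| <= (#|F :\: T0|).*2.
  by apply: (card_branch ends2) => // x; have := hdeg x; rewrite !inE => /or3P[]/eqP->.
apply: leq_trans (leq_card_setU _ _) _;
  apply: leq_trans (leq_add (leq_card_setU _ _) (leq_imset_card h Y)) _.
rewrite -/Y in cY; clear -cY hbr t3 hk; lia.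
Qed.

End Key.

(** * Finding circuits for all the cycles of H *)

Section Family.
Variables (V W : finType) (ends : W -> {set V}).
Hypothesis ends2 : forall e, #|ends e| = 2.
Local Notation chain := {set W}.
Local Notation supp := (supp ends).
Local Notation circuit := (circuit ends).

Variables (r : nat) (len : 'I_r -> nat) (l m L : nat).
Hypothesis len_le : forall i, len i <= l.
Hypothesis mL : m.*2 + 3 <= L.
Hypothesis Lm : (r * L).*2 < 2 ^ m.

Definition circuit_family (E : chain) (I : {set 'I_r}) (C : 'I_r -> chain) :=
  (forall i, i \in I -> [/\ circuit (C i), C i \subset E & len i <= #|C i|]) /\
  (forall i j, i \in I -> j \in I -> i != j -> [disjoint supp (C i) & supp (C j)]).

(** A circuit of medium length for the longest remaining cycle [i0] costs fewer than [(len i0).*2]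
    deleted vertices, which is its share of the sum. The term 3rL + r is paid only once, since the
    process stops as soon as there is no medium circuit. *)
Lemma family_or_hitting (E : chain) (I : {set 'I_r}) :
  (exists C, circuit_family E I C) \/
  exists X : {set V}, #|X| <= \sum_(i in I) (len i).*2 + (3 * (r * L) + r) /\
    forall Z, circuit Z -> Z \subset E -> [disjoint supp Z & X] -> #|Z| < l.
Proof.
elim: {I}_.+1 {-2}I (ltnSn #|I|) E => // n IH I hn E.
case: (set_0Vmem I) => [->|[i1 hi1]].
  by left; exists (fun=> set0); split=> i; rewrite ?inE // => j; rewrite inE.
have [i0 hi0 hmax] : exists2 i0, i0 \in I & forall i, i \in I -> len i <= len i0.
  by case: (arg_maxnP len hi1) => i0 h1 h2; exists i0.
case: (boolP [exists C : chain, [&& circuit C, C \subset E, len i0 <= #|C| & #|C| < (len i0).*2]]).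
  case/existsP=> C /and4P[c1 c2 c3 c4].
  pose E' := [set e in E | [disjoint ends e & supp C]].
  have E'E : E' \subset E by apply/subsetP=> e; rewrite inE => /andP[].
  have dis (D : chain) : D \subset E' -> [disjoint supp D & supp C].
    move=> hD; apply/pred0P=> x /=; apply/negP=> /andP[/suppP[e he hx] hxC].
    by have := subsetP hD _ he; rewrite inE => /andP[_ h]; have := disjointFr h hx; rewrite hxC.
  have [|[C' [f1 f2]]|[X [x1 x2]]] := IH (I :\ i0) _ E'.
  - by rewrite (cardsD1 i0) hi0 in hn.
  - left; exists (fun i => if i == i0 then C else C' i); split.
      move=> i hi; case: (eqVneq i i0) => [->|hne]; first by split.
      have [|g1 g2 g3] := f1 i; first by rewrite !inE hne.
      by split=> //; apply: subset_trans g2 E'E.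
    move=> i j hi hj hij; case: (eqVneq i i0) => hi'; case: (eqVneq j i0) => hj'.
    + by rewrite hi' hj' eqxx in hij.
    + by have [|_ g _] := f1 j; [rewrite !inE hj' | rewrite disjoint_sym dis].
    + by have [|_ g _] := f1 i; [rewrite !inE hi' | rewrite dis].
    + by apply: f2; rewrite // !inE ?hi' ?hj'.
  - right; exists (X :|: supp C); split.
      apply: leq_trans (leq_card_setU _ _) _;
        rewrite (big_setD1 i0) //= (card_supp_circuit ends2 c1).
      by rewrite addnC -addnA; apply: leq_add => //; apply: ltnW.
    move=> Z z1 z2 z3; apply: x2 => //; last by apply: disjointWr z3; apply: subsetUl.
    apply/subsetP=> e he; rewrite inE (subsetP z2 _ he) /=.
    apply/pred0P=> x /=; apply/negP=> /andP[hx hxC].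
    by have := disjointFr z3 (mem_supp he hx); rewrite inE hxC orbT.
rewrite negb_exists => /forallP hno.
have hmed : no_medium ends E (len i0).
  by move=> C c1 c2 c3; have := hno C; rewrite c1 c2 c3 /= -leqNgt.
case: (packing_or_hitting ends2 hmed mL Lm) => [[s [s1 s2 s3]]|[X x1 x2]].
  (* The packing has r circuits, however few indices remain in [I], so [i] can itself serve as the
     position in [s]; each circuit is long enough for every index, as [len i0] is the largest. *)
  left; exists (fun i : 'I_r => nth set0 s i); split.
    move=> i hi; have := allP s2 (nth set0 s i);
      rewrite mem_nth ?s1 // => /(_ isT) /and3P[g1 g2 g3].
    by split=> //; apply: leq_trans (hmax i hi) g3.
  have hlt (i j : 'I_r) : i < j -> [disjoint supp (nth set0 s i) & supp (nth set0 s j)].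
    by move=> hij; move/(pairwiseP set0): s3; apply; rewrite ?inE ?s1.
  move=> i j _ _ hij; case: (ltngtP i j) => h; first exact: hlt.
    by rewrite disjoint_sym; apply: hlt.
  by case/eqP: hij; apply: val_inj.
right; exists X; split; first by apply: leq_trans x2 _; apply: leq_addl.
move=> Z z1 z2 z3; rewrite ltnNge; apply/negP=> h.
by have := x1 Z z1 z2 (leq_trans (len_le i0) h); rewrite z3.
Qed.

End Family.

(** * From chains back to graphs *)

Section GraphChains.
Variables (V : finType) (G : rel V).
Hypothesis G_simple : simple_graph G.

Definition is_edge (e : {set V}) := [exists x, exists y, (e == [set x; y]) && G x y].
Definition edge := {e : {set V} | is_edge e}.
Definition ends (e : edge) : {set V} := val e.

Lemma ends2 e : #|ends e| = 2.
Proof.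
case: e => e he; rewrite /ends /=; case/existsP: he => x /existsP[y /andP[/eqP-> h]].
by rewrite cards2; case: eqP => // hxy; rewrite hxy (G_simple.2 y) in h.
Qed.

Lemma ends_adj e x y : ends e = [set x; y] -> x != y -> G x y.
Proof.
case: e => e he; rewrite /ends /=; case/existsP: (he) => a /existsP[b /andP[/eqP-> h]] hs hxy.
have : x \in [set a; b] by rewrite hs !inE eqxx.
have : y \in [set a; b] by rewrite hs !inE eqxx orbT.
rewrite !inE => /orP[]/eqP hy /orP[]/eqP hx; rewrite hx hy ?eqxx // in hxy *.
by rewrite G_simple.1.
Qed.

Lemma adj_edge x y : G x y -> exists e, ends e = [set x; y].
Proof.
move=> h; have he : is_edge [set x; y].
  by apply/existsP; exists x; apply/existsP; exists y; rewrite eqxx.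
by exists (Sub [set x; y] he); rewrite /ends SubK.
Qed.

Lemma adj_rel C x y : adj ends C x y -> G x y.
Proof.
case/exists_inP=> e _ /eqP he; apply: (ends_adj he).
by have := ends2 e; rewrite he cards2; case: eqP.
Qed.

Lemma path_chain x p : path G x p -> uniq (x :: p) -> p != [::] ->
  exists P, [/\ minpath ends x (last x p) P, #|P| = size p & supp ends P \subset x :: p].
Proof.
elim: p x => // y p IH x /= /andP[hxy hp] /and3P[hx hy hu] _.
have [e he] := adj_edge hxy.
have nxy : x != y by apply: contraNneq hx => ->; rewrite inE eqxx.
have bde : bd ends [set e] = symd [set x] [set y] by rewrite bd1 he symd_pair.
case: (eqVneq p [::]) => [->|hp0] /=.
  exists [set e]; rewrite cards1 supp1; split=> //; last first.
    by apply/subsetP=> z; rewrite he !inE.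
  apply/minsetP; split=> [|B /eqP hb]; first exact/eqP.
  rewrite subset1 => /orP[/eqP//|/eqP h0].
  by move: hb; rewrite h0 bd0 => /esym/symd_eq0/set1_inj h; rewrite h eqxx in nxy.
have [|P [p1 p2 p3]] := IH y hp _ hp0; first by rewrite /= hy hu.
have xP : x \notin supp ends P by apply: contra hx => /(subsetP p3).
have xe : x \in ends e by rewrite he !inE eqxx.
have eP : e \notin P by apply: contra xP => h; apply: mem_supp h xe.
have hsP : [set e] :|: P = symd [set e] P by rewrite symd_disj // disjoints1.
exists (e |: P); split.
- apply: acyclic_minpath; last by rewrite hsP bd_symd bde (minpath_bd p1) symd_tri.
  apply/acyclicP=> D hD hb; apply: (acyclicP _ _ (minpath_acyclic p1)) => //.
  apply/subsetP=> f hf; have := subsetP hD _ hf; rewrite !inE => /orP[/eqP hfe|//].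
  rewrite hfe in hf; have := in_bd ends D x; rewrite hb in_set0.
  rewrite (_ : deg ends D x = 1) // /deg (_ : star _ _ _ = [set e]) ?cards1 //.
  apply/setP=> g; rewrite in_set in_set1; apply/andP/eqP => [[hg hgx]|-> //].
  have := subsetP hD _ hg; rewrite !inE => /orP[/eqP//|hgP].
  by rewrite (mem_supp hgP hgx) in xP.
- by rewrite cardsU1 eP p2.
- apply/subsetP=> z; rewrite suppU supp1 in_setU he in_set2 !in_cons -orbA.
  by case/or3P=> [->|->|/(subsetP p3)]; rewrite ?orbT // in_cons => ->; rewrite orbT.
Qed.

Lemma cycle_circuit s : cycle G s -> uniq s -> 2 < size s ->
  exists C, [/\ circuit ends C, #|C| = size s & supp ends C \subset s].
Proof.
case: s => // x p; rewrite /= rcons_path => /andP[hp hl] hu hs.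
have hp0 : p != [::] by case: p hs {hp hl hu}.
have [P [p1 p2 p3]] := path_chain hp hu hp0.
have [e he] := adj_edge hl.
have nxl : x != last x p.
  by apply: contraTneq hu => ->; case: p hp0 {hs hp hl p1 p2 p3 he} => //= y p _; rewrite mem_last.
have bde : bd ends [set e] = symd [set x] [set last x p].
  by rewrite bd1 he symd_pair // setUC.
(* If the closing edge lay in the path, it would be the whole path by minimality, and the cycle
   would have only two vertices. *)
have eP : e \notin P.
  apply/negP=> h; have := minpath_min p1 (_ : [set e] \subset P) bde.
  rewrite sub1set h => /(_ isT) h1; move: hs; rewrite -p2 -h1 cards1.
  by [].
have hsP : [set e] :|: P = symd [set e] P by rewrite symd_disj // disjoints1.
exists (e |: P); split; last first.
- apply/subsetP=> z; rewrite suppU supp1 in_setU he in_set2 -orbA.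
  by case/or3P=> [/eqP->|/eqP->|/(subsetP p3)//]; [apply: mem_last | apply: mem_head].
- by rewrite cardsU1 eP p2.
apply/minsetP; split=> [|D /andP[hD0 /eqP hb] hD].
  rewrite /even_chain hsP bd_symd bde (minpath_bd p1) symdd eqxx andbT -hsP.
  by apply/set0Pn; exists e; rewrite !inE eqxx.
have eD : e \in D.
  apply: contraNT hD0 => heD; apply/eqP; apply: (acyclicP _ _ (minpath_acyclic p1)) => //.
  apply/subsetP=> f hf; have := subsetP hD _ hf; rewrite !inE => /orP[/eqP hfe|//].
  by rewrite -hfe hf in heD.
rewrite -(setD1K eD); congr (_ |: _); apply: (minpath_min p1).
  apply/subsetP=> f; rewrite !inE => /andP[hfe /(subsetP hD)]; rewrite !inE (negPf hfe).
  by [].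
by rewrite -symd_setD ?sub1set // bd_symd hb bde sym0d.
Qed.

End GraphChains.

(** * A minor model from disjoint cycles that are long enough *)

Section Minor.
Variables (r : nat) (len : 'I_r -> nat).
Variables (V : finType) (G : rel V).
Hypothesis G_simple : simple_graph G.
Variable s : 'I_r -> seq V.
Hypothesis s_cycle : forall i, cycle G (s i).
Hypothesis s_uniq : forall i, uniq (s i).
Hypothesis s_size : forall i, 2 < len i <= size (s i).
Hypothesis s_disj : forall i j x, x \in s i -> x \in s j -> i = j.

(* The vertices of [s i] beyond the first [len i - 1] all go to the last branch set. *)
Definition branch_set (x : cycles_vertex len) : {set V} :=
  [set y in s (tag x) | minn (index y (s (tag x))) (len (tag x)).-1 == tagged x :> nat].

Lemma cycle_nth x0 i k : k.+1 < size (s i) -> G (nth x0 (s i) k) (nth x0 (s i) k.+1).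
Proof.
move: (s_cycle i); case: (s i) => // x p; rewrite /= rcons_path => /andP[/(pathP x0) h _] hk.
exact: h.
Qed.

Lemma cycle_wrap x0 i : G (nth x0 (s i) (size (s i)).-1) (nth x0 (s i) 0).
Proof.
have := s_size i; move: (s_cycle i); case: (s i) => [|x p]; first by rewrite /= andbC;
  case: (len i).
by rewrite /= rcons_path nth_last /= => /andP[].
Qed.

Lemma nth_branch x0 (i : 'I_r) (a : 'I_(len i)) k : k < size (s i) -> minn k (len i).-1 = a ->
  nth x0 (s i) k \in branch_set (Tagged (fun i => 'I_(len i)) a).
Proof.
by move=> hk ha; rewrite inE mem_nth //= index_uniq // ha eqxx.
Qed.

Lemma cycles_minor : is_minor (@cycles_edge r len) G.
Proof.
have arith i (a : 'I_(len i)) : minn a (len i).-1 = a /\ a < size (s i).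
  by have := s_size i; have := ltn_ord a; lia.
exists branch_set; split.
- case=> i a; have [h1 h2] := arith i a; apply/set0Pn.
  case hs: (s i) h2 => [//|x0 p] _; exists (nth x0 (s i) a).
  by apply: nth_branch; [case: (arith i a) | ].
- case=> i a.
  set S := branch_set _.
  have memS y : y \in S -> y \in s i /\ minn (index y (s i)) (len i).-1 = a.
    by rewrite inE /= => /andP[h /eqP].
  have symS : connect_sym (restrict_rel S G).
    by apply: sym_connect_sym => u v; rewrite /restrict_rel andbCA G_simple.1.
  (* A branch set is a stretch of consecutive vertices of [s i] starting at position [a]; every
     vertex walks back to that start. *)
  have down u : u \in S -> connect (restrict_rel S G) u (nth u (s i) a).
    move=> hu; have [hus hia] := memS _ hu; rewrite -{1}(nth_index u hus).
    have ha : a <= index u (s i) by rewrite -hia geq_minl.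
    have : index u (s i) < size (s i) by rewrite index_mem.
    have : minn (index u (s i)) (len i).-1 = a by [].
    elim: (index u (s i)) ha {hia} => [|k IH].
      by rewrite leqn0 => /eqP->.
    rewrite leq_eqVlt => /orP[/eqP-> //|hak] hia hk.
    have hka : minn k (len i).-1 = a by clear -hia hak; lia.
    apply: connect_trans (IH hak hka (ltnW hk)); rewrite symS; apply: connect1.
    rewrite /restrict_rel cycle_nth // andbT.
    by rewrite (nth_branch u (ltnW hk) hka) (nth_branch u hk hia).
  move=> u v hu hv; apply: connect_trans (down u hu) _; rewrite symS.
  by have [_ h] := arith i a; rewrite (set_nth_default v) //; apply: down.
- case=> i a [j b] hne; apply/pred0P=> y /=; apply/negP=> /andP[].
  rewrite !inE /= => /andP[h1 /eqP h2] /andP[h3 /eqP h4].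
  have hij := s_disj h1 h3; case: _ / hij in b hne h3 h4 *.
  by case/eqP: hne; congr (Tagged _ _); apply: val_inj; rewrite /= -h2 -h4.
have step i (a b : 'I_(len i)) : b = a.+1 %% len i :> nat ->
    exists u v, [/\ u \in branch_set (Tagged (fun i => 'I_(len i)) a),
      v \in branch_set (Tagged (fun i => 'I_(len i)) b) & G u v].
  move=> hb; have /andP[l1 l2] := s_size i; have ha := ltn_ord a.
  case hs: (s i) => [|x0 p]; first by rewrite hs in l2; clear -l1 l2; case: (len i) l1 l2.
  move: hb; case: (ltnP a.+1 (len i)) => h hb.
    rewrite modn_small // in hb.
    exists (nth x0 (s i) a), (nth x0 (s i) a.+1); split.
    - by apply: nth_branch; clear -h l2 ha; lia.
    - by apply: nth_branch; rewrite ?hb; clear -h l2 ha; lia.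
    - by apply: cycle_nth; clear -h l2; lia.
  have haL : a.+1 = len i by apply/eqP; rewrite eqn_leq ha h.
  rewrite haL modnn in hb.
  (* The last branch set reaches to the end of [s i], so the closing edge of the cycle joins it to
     the first branch set. *)
  exists (nth x0 (s i) (size (s i)).-1), (nth x0 (s i) 0); split.
  - by apply: nth_branch; clear -haL l1 l2; lia.
  - by apply: nth_branch; rewrite ?hb ?min0n //; clear -l1 l2; lia.
  - exact: cycle_wrap.
case=> i a [j b]; rewrite /cycles_edge /= => /andP[/eqP hij].
case: _ / hij in b * => /= /orP[]/eqP h; first exact: step.
by have [u [v [h1 h2 h3]]] := step i b a h; exists v, u; rewrite G_simple.1.
Qed.

End Minor.

(** * Tree decompositions from depth-first forests *)

Section RootedTree.
Variables (T : finType) (par : T -> T) (rank : T -> nat) (root : T).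
Hypothesis rank_par : forall t, t != root -> rank (par t) < rank t.

Definition tree_rel : rel T := fun s t =>
  (s != root) && (par s == t) || (t != root) && (par t == s).

Lemma tree_rel_sym : symmetric tree_rel.
Proof. by move=> s t; rewrite /tree_rel orbC. Qed.

Lemma tree_connected (S : {set T}) r : r \in S ->
  (forall t, t \in S -> t != r -> (t != root) && (par t \in S)) -> connected_in tree_rel S.
Proof.
move=> hr hS.
have symS : connect_sym (restrict_rel S tree_rel).
  by apply: sym_connect_sym => u v; rewrite /restrict_rel andbCA tree_rel_sym.
have up t : t \in S -> connect (restrict_rel S tree_rel) t r.
  elim: {t}_.+1 {-2}t (ltnSn (rank t)) => // n IH t hn ht.
  case: (eqVneq t r) => [->|htr]; first exact: connect0.
  have /andP[h1 h2] := hS t ht htr.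
  apply: connect_trans (connect1 _) (IH (par t) _ h2); last exact: leq_trans (rank_par h1) hn.
  by rewrite /restrict_rel ht h2 /tree_rel h1 eqxx.
by move=> u v hu hv; apply: connect_trans (up u hu) _; rewrite symS; apply: up.
Qed.

(** On a cycle of length at least 3, a vertex of maximal rank would have its parent as both of its
    distinct neighbours. *)
Lemma rooted_tree : is_tree tree_rel.
Proof.
split.
- split; first exact: tree_rel_sym.
  move=> t; rewrite /tree_rel orbb; apply/negP=> /andP[/rank_par h /eqP heq].
  by rewrite heq ltnn in h.
- move=> s t.
  have h : connected_in tree_rel [set: T].
    by apply: (@tree_connected _ root) => // u _ hu; rewrite hu inE.
  have := h s t (in_setT s) (in_setT t); apply: connect_sub => u v.
  by rewrite /restrict_rel !inE /= => huv; apply: connect1.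
move=> s hs hu; apply/negP=> hc.
have [x0 hx0] : exists x, x \in s by case: s hs {hu hc} => // x s; exists x; rewrite mem_head.
case: (@arg_maxnP _ x0 (mem s) rank hx0) => x hx hmax.
have [i s' hs'] := rot_to hx.
have hc' : cycle tree_rel (x :: s') by rewrite -hs' rot_cycle.
have hu' : uniq (x :: s') by rewrite -hs' rot_uniq.
have hsz : 2 < size (x :: s') by rewrite -hs' size_rot.
have mem_s y : y \in x :: s' -> y \in s by rewrite -hs' mem_rot.
have top y : y \in x :: s' -> tree_rel x y -> par x = y.
  move=> hy /orP[/andP[_ /eqP//]|/andP[h1 /eqP h2]].
  by have := rank_par h1; rewrite h2 ltnNge; have := hmax y (mem_s y hy) => /= ->.
case: s' hsz hc' hu' {hs' mem_s} top => [|y [|z s']] // _ hc' hu' top.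
move: hc'; rewrite /= rcons_path => /and3P[h1 _] /andP[_ h2].
have hyx : y \in [:: x, y, z & s'] by rewrite !inE eqxx orbT.
have hl : last z s' \in [:: x, y, z & s'] by rewrite 2!in_cons mem_last !orbT.
rewrite tree_rel_sym in h2; have e1 := top y hyx h1; have e2 := top _ hl h2.
move: hu'; rewrite /= => /and3P[_ hy _]; case/negP: hy.
by rewrite -e1 e2 mem_last.
Qed.

End RootedTree.

(** * Depth-first search and the decomposition it yields *)

Section DepthFirst.
Variables (V : finType) (G : rel V).
Hypothesis G_simple : simple_graph G.

(** One call of depth-first search at [h], with stack [h :: s] and unvisited set [D]. [D1] is what
    the call visits and [st x] is the stack once [x] has been pushed. The third clause says that the
    call is exhaustive, the fourth that edges join only ancestors and descendants. *)
Lemma dfs_from n (D : {set V}) h s : #|D| < n ->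
  exists (D1 : {set V}) (st : V -> seq V),
  [/\ D1 \subset D,
      forall x, x \in D1 -> {subset h :: s <= st x} /\ exists t, st x = x :: t /\
        ((t = h :: s /\ G x h) \/ exists u, [/\ u \in D1, t = st u & G x u]),
      forall x y, x \in h |: D1 -> y \in D :\: D1 -> ~~ G x y
    & forall x y, x \in D1 -> y \in D1 -> G x y -> x \in st y \/ y \in st x].
Proof.
elim: n D h s => // n IH D h s hn.
case: (boolP [exists v in D, G h v]) => [/exists_inP[v hv hhv]|]; last first.
  rewrite negb_exists_in => /forall_inP hno; exists set0, (fun=> [::]); split.
  - exact: sub0set.
  - by move=> x; rewrite inE.
  - by move=> x y; rewrite setU0 inE setD0 => /eqP->; apply: hno.
  - by move=> x y; rewrite inE.
have hDv : #|D :\ v| < n by rewrite (cardsD1 v) hv in hn.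
(* The search below the child [v] visits [D2]; the call at [h] then resumes on what is left and
   visits [D3]. Exhaustiveness of the former excludes edges from [v] or [D2] to [D3]. *)
have [D2 [st2 [a1 a2 a3 a4]]] := IH (D :\ v) v (h :: s) hDv.
have hD3 : #|(D :\ v) :\: D2| < n.
  by apply: leq_ltn_trans hDv; apply: subset_leq_card; apply: subsetDl.
have [D3 [st3 [b1 b2 b3 b4]]] := IH ((D :\ v) :\: D2) h s hD3.
have vD2 : v \notin D2 by apply/negP=> /(subsetP a1); rewrite !inE eqxx.
have D3n x : x \in D3 -> [/\ x \in D, x != v & x \notin D2].
  by move/(subsetP b1); rewrite !inE => /and3P[].
have D2n x : x \in D2 -> [/\ x \in D & x != v].
  by move/(subsetP a1); rewrite !inE => /andP[].
pose st x := if x == v then v :: h :: s else if x \in D2 then st2 x else st3 x.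
have stv : st v = v :: h :: s by rewrite /st eqxx.
have st2E x : x \in D2 -> st x = st2 x by move=> hx; have [_ hxv] := D2n x hx;
  rewrite /st (negPf hxv) hx.
have st3E x : x \in D3 -> st x = st3 x.
  by move=> hx; have [_ hxv hx2] := D3n x hx; rewrite /st (negPf hxv) (negPf hx2).
have no23 x y : x \in v |: D2 -> y \in D3 -> ~~ G x y.
  move=> hx hy; apply: a3 => //; have [h1 h2 h3] := D3n y hy; by rewrite !inE h1 h2 h3.
exists (v |: (D2 :|: D3)), st; split.
- apply/subsetP=> x; rewrite !inE => /or3P[/eqP-> //|/D2n[]//|/D3n[]//].
- move=> x; rewrite !inE => /or3P[/eqP->|hx|hx].
  + rewrite stv; split; first by move=> y hy; rewrite inE hy orbT.
    by exists (h :: s); split=> //; left; rewrite G_simple.1.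
  + rewrite st2E //; have [c1 [t [c2 c3]]] := a2 x hx; split.
      by move=> y hy; apply: c1; rewrite inE hy orbT.
    exists t; split=> //; right; case: c3 => [[-> hxv]|[u [u1 u2 u3]]].
      by exists v; rewrite stv !inE eqxx.
    by exists u; rewrite st2E // !inE u1 orbT.
  + rewrite st3E //; have [c1 [t [c2 c3]]] := b2 x hx; split=> //.
    exists t; split=> //; case: c3 => [?|[u [u1 u2 u3]]]; [by left|right].
    by exists u; rewrite st3E // !inE u1 !orbT.
- move=> x y hx hy.
  have hyD : y \in (D :\ v :\: D2) :\: D3.
    by move: hy; rewrite !inE !negb_or => /andP[/and3P[-> -> ->] ->].
  have hyD2 : y \in (D :\ v) :\: D2 by move: hyD; rewrite in_setD => /andP[].
  move: hx; rewrite !inE => /or4P[hx|hx|hx|hx].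
  + by apply: b3; rewrite // in_setU1 hx.
  + by apply: a3; rewrite // in_setU1 hx.
  + by apply: a3; rewrite // in_setU1 hx orbT.
  + by apply: b3; rewrite // in_setU1 hx orbT.
- have vst y : y \in D2 -> v \in st y.
    by move=> hy; rewrite st2E //; have [c1 _] := a2 y hy; apply: c1; rewrite mem_head.
  move=> x y; rewrite !inE => /or3P[/eqP->|hx|hx] /or3P[/eqP->|hy|hy] hG.
  + by left; rewrite stv mem_head.
  + by left; apply: vst.
  + by have := no23 v y; rewrite hG !inE eqxx => /(_ isT hy).
  + by right; apply: vst.
  + by rewrite !st2E //; apply: a4.
  + by have := no23 x y; rewrite hG !inE hx orbT => /(_ isT hy).
  + by have := no23 v x; rewrite G_simple.1 hG !inE eqxx => /(_ isT hx).
  + by have := no23 y x; rewrite G_simple.1 hG !inE hy orbT => /(_ isT hx).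
  + by rewrite !st3E //; apply: b4.
Qed.

(* [st x] lists [x] and its ancestors in a depth-first forest of [G[D]]. *)
Lemma dfs_forest (D : {set V}) : exists st : V -> seq V,
  (forall x, x \in D -> exists t, st x = x :: t /\
        (t = [::] \/ exists u, [/\ u \in D, t = st u & G x u])) /\
  (forall x y, x \in D -> y \in D -> G x y -> x \in st y \/ y \in st x).
Proof.
elim: {D}_.+1 {-2}D (ltnSn #|D|) => // n IH D hn.
case: (set_0Vmem D) => [->|[v hv]].
  by exists (fun=> [::]); split=> x; [|move=> y]; rewrite inE.
have hDv : #|D :\ v| < n by rewrite (cardsD1 v) hv in hn.
have [D2 [st2 [a1 a2 a3 a4]]] := dfs_from v [::] hDv.
have hD3 : #|(D :\ v) :\: D2| < n.
  by apply: leq_ltn_trans hDv; apply: subset_leq_card; apply: subsetDl.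
have [st3 [b2 b4]] := IH _ hD3; set D3 := (D :\ v) :\: D2 in hD3 b2 b4 a3.
have D2n x : x \in D2 -> [/\ x \in D & x != v].
  by move/(subsetP a1); rewrite !inE => /andP[].
have D3n x : x \in D3 -> [/\ x \in D, x != v & x \notin D2].
  by rewrite !inE => /and3P[].
pose st x := if x == v then [:: v] else if x \in D2 then st2 x else st3 x.
have stv : st v = [:: v] by rewrite /st eqxx.
have st2E x : x \in D2 -> st x = st2 x by move=> hx; have [_ hxv] := D2n x hx;
  rewrite /st (negPf hxv) hx.
have st3E x : x \in D3 -> st x = st3 x.
  by move=> hx; have [_ hxv hx2] := D3n x hx; rewrite /st (negPf hxv) (negPf hx2).
have Dsplit x : x \in D -> [|| x == v, x \in D2 | x \in D3].
  by move=> hx; rewrite !inE hx; case: (x == v); case: (x \in D2).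
exists st; split.
  move=> x /Dsplit /or3P[/eqP->|hx|hx].
  - by rewrite stv; exists [::]; split=> //; left.
  - rewrite st2E //; have [_ [t [c2 c3]]] := a2 x hx.
    exists t; split=> //; right; case: c3 => [[-> hxv]|[u [u1 u2 u3]]].
      by exists v; rewrite stv.
    by exists u; rewrite st2E //; have [] := D2n u u1.
  - rewrite st3E //; have [t [c2 c3]] := b2 x hx.
    exists t; split=> //; case: c3 => [?|[u [u1 u2 u3]]]; [by left|right].
    by exists u; rewrite st3E //; have [] := D3n u u1.
have vst y : y \in D2 -> v \in st y.
  by move=> hy; rewrite st2E //; have [c1 _] := a2 y hy; apply: c1; rewrite mem_head.
move=> x y /Dsplit /or3P[/eqP->|hx|hx] /Dsplit /or3P[/eqP->|hy|hy] hG.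
- by left; rewrite stv mem_head.
- by left; apply: vst.
- by have := a3 v y; rewrite hG in_setU1 eqxx => /(_ isT hy).
- by right; apply: vst.
- by rewrite !st2E //; apply: a4.
- by have := a3 x y; rewrite hG in_setU1 hx orbT => /(_ isT hy).
- by have := a3 v x; rewrite G_simple.1 hG in_setU1 eqxx => /(_ isT hx).
- by have := a3 y x; rewrite G_simple.1 hG in_setU1 hy orbT => /(_ isT hx).
- by rewrite !st3E //; apply: b4.
Qed.

Variables (X : {set V}) (l : nat).
Hypothesis l_gt1 : 1 < l.
Hypothesis short_cycles : forall s, cycle G s -> uniq s -> 2 < size s ->
  {subset s <= ~: X} -> size s < l.

Lemma treewidth_short_cycles : treewidth_le G (#|X| + l).
Proof.
set D := ~: X.
have [st [hst hcomp]] := dfs_forest D.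
have struct n x : x \in D -> size (st x) <= n ->
  [/\ uniq (st x), {subset st x <= D}, path G x (behead (st x)) &
      forall y, y \in st x -> size (st y) <= size (st x)].
  elim: n x => [|n IH] x hx; have [t [et ht]] := hst x hx; first by rewrite et.
  move=> hn; case: ht => [t0|[u [u1 u2 u3]]].
    rewrite et t0; split=> //; first by move=> y; rewrite inE => /eqP->.
    by move=> y; rewrite inE => /eqP->; rewrite et t0.
  have hsu : size (st u) <= n by rewrite et u2 in hn.
  have [i1 i2 i3 i4] := IH u u1 hsu; have [t' [et' _]] := hst u u1.
  rewrite et u2; split.
  - rewrite cons_uniq i1 andbT; apply/negP=> /i4; rewrite et u2 /=; by rewrite ltnn.
  - by move=> y; rewrite inE => /orP[/eqP->//|/i2].
  - by rewrite /= et' /= u3; move: i3; rewrite et'.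
  - by move=> y; rewrite inE => /orP[/eqP->|/i4 h]; [rewrite et u2 | apply: leqW].
have {struct} struct x (hx : x \in D) := struct _ x hx (leqnn _).
(* [None] is an extra root that joins the forest into one tree; the vertices of [X] become children
   of it with bag [X]. *)
pose par (t : option V) : option V :=
  if t is Some x then if x \in D then ohead (behead (st x)) else None else None.
pose rank (t : option V) := if t is Some x then if x \in D then size (st x) else 1 else 0.
have par_some x : x \in D -> st x = [:: x] /\ par (Some x) = None \/
    exists u, [/\ u \in D, st x = x :: st u & par (Some x) = Some u].
  move=> hx; have [t [et [t0|[u [u1 u2 u3]]]]] := hst x hx.
    by left; rewrite /par hx et t0.
  right; exists u; split; rewrite ?et ?u2 //.
  by have [t' [et' _]] := hst u u1; rewrite /par hx et u2 et'.
have hrank t : t != None -> rank (par t) < rank t.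
  case: t => // x _; case: (boolP (x \in D)) => hx; last by rewrite /rank /par (negPf hx).
  case: (par_some x hx) => [[h1 ->]|[u [u1 u2 ->]]]; first by rewrite /rank hx h1.
  by rewrite /rank hx u1 u2.
pose bag (t : option V) : {set V} :=
  if t is Some x then if x \in D then X :|: [set y in take l (st x)] else X else X.
have XB t : X \subset bag t by case: t => [x|] //=; case: ifP => // _; apply: subsetUl.
have inbag v t : v \in D -> v \in bag t -> exists x, [/\ t = Some x, x \in D & v \in take l (st x)].
  move=> hv; have hvX : v \notin X by rewrite -in_setC.
  case: t => [x|] /=; last by rewrite (negPf hvX).
  case: (boolP (x \in D)) => hx; last by rewrite (negPf hvX).
  by rewrite !inE (negPf hvX) => h; exists x.
have bagx x v : x \in D -> v \in take l (st x) -> v \in bag (Some x).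
  by move=> hx hv; rewrite /= hx !inE hv orbT.
have self x : x \in D -> x \in bag (Some x).
  move=> hx; apply: bagx => //; have [t [-> _]] := hst x hx.
  by case: l l_gt1 => // l' _; rewrite /= mem_head.
(* The tree path from [v] up to [u] and the edge between them close a cycle. If [u] were at position
   l or beyond, this cycle would have more than l vertices, and at least 3 because l > 1. *)
have anc u v : u \in D -> v \in D -> G u v -> u \in st v -> u \in take l (st v).
  move=> hu hv hG huv; rewrite in_take // ltnNge; apply/negP=> hl.
  have [c1 c2 c3 _] := struct v hv; have [t [et _]] := hst v hv.
  have hi : index u (st v) < size (st v) by rewrite index_mem.
  pose s := take (index u (st v)).+1 (st v).
  have ss : size s = (index u (st v)).+1 by rewrite size_takel.
  have : size s < l.
    apply: short_cycles.
    - have es : s = v :: take (index u (st v)) t by rewrite /s et.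
      rewrite es /= rcons_path; apply/andP; split.
        by move: c3; rewrite et /= => c3; apply: take_path.
      rewrite (_ : last v _ = u) // -[last v _](_ : last v s = _); last by rewrite es.
      by rewrite (last_nth v) ss /= es -[_ :: take _ _]es /s nth_take // nth_index.
    - exact: take_uniq.
    - by rewrite ss ltnS (leq_trans l_gt1 hl).
    - by move=> y /mem_take; apply: c2.
  by rewrite ss ltnNge leqW.
exists (option V : finType), (tree_rel par None), bag; split.
- exact: rooted_tree hrank.
- move=> v; case: (boolP (v \in X)) => hv; first by exists None.
  by exists (Some v); apply: self; rewrite inE.
- move=> u v hG; case: (boolP (u \in X)) => hu.
    case: (boolP (v \in X)) => hv; first by exists None.
    by exists (Some v); split; [apply: (subsetP (XB _)) | apply: self; rewrite inE].
  have huD : u \in D by rewrite inE.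
  case: (boolP (v \in X)) => hv.
    by exists (Some u); split; [apply: self | apply: (subsetP (XB _))].
  have hvD : v \in D by rewrite inE.
  case: (hcomp u v huD hvD hG) => h.
    by exists (Some v); split; [apply: bagx => //; apply: anc | apply: self].
  by exists (Some u); split; [apply: self | apply: bagx => //; apply: anc; rewrite // G_simple.1].
- move=> v; case: (boolP (v \in X)) => hv.
    apply: (@tree_connected _ par rank None hrank _ None); first by rewrite inE;
      apply: (subsetP (XB _)).
    by move=> t _ ht; rewrite ht inE (subsetP (XB _)).
  have hvD : v \in D by rewrite inE.
  (* The top node for [v] is [Some v]. Going from any other such node to its parent moves [v] one
     place forward in the ancestor list, so it stays among the first l entries. *)
  apply: (@tree_connected _ par rank None hrank _ (Some v)); first by rewrite inE self.
  move=> t; rewrite inE => /(inbag v t hvD)[x [-> hx hvx]] hne.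
  have hxv : v != x by apply: contraNneq hne => ->.
  have hvt : v \in st x by apply: mem_take hvx.
  case: (par_some x hx) => [[h1 _]|[u [u1 u2 ->]]].
    by rewrite h1 inE (negPf hxv) in hvt.
  apply/andP; split=> //; rewrite inE; apply: bagx => //.
  move: hvx; rewrite u2; case: l l_gt1 => // l' _.
  rewrite /= inE (negPf hxv) /= => h.
  by have := in_take l'.+1 (mem_take h); have := in_take l' (mem_take h);
    rewrite h => /esym h' ->; apply: ltnW.
- move=> t; apply: leq_trans (_ : #|X| + l <= _); last exact: leqnSn.
  case: t => [x|] /=; last exact: leq_addr.
  case: ifP => _; last exact: leq_addr.
  apply: leq_trans (leq_card_setU _ _) _; rewrite leq_add2l.
  apply: leq_trans (_ : size (take l (st x)) <= _); last by rewrite size_take; case: ltnP.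
  by rewrite cardsE; apply: card_size.
Qed.

End DepthFirst.

(** * The bound on f(H) in terms of m and L, and the choice of these *)

Lemma treewidth_leW (V : finType) (G : rel V) n n' :
  n <= n' -> treewidth_le G n -> treewidth_le G n'.
Proof.
move=> hn [T [ET [B [h1 h2 h3 h4 h5]]]]; exists T, ET, B; split=> // t.
exact: leq_trans (h5 t) _.
Qed.

Lemma card_cycles_vertex r (len : 'I_r -> nat) : #|cycles_vertex len| = \sum_i len i.
Proof. by rewrite card_tagged sumnE big_map big_enum /=; apply: eq_bigr=> i _;
  rewrite card_ord. Qed.

(** With h the number of vertices of H, 2h pays for the deleted medium circuits, and another h, an
    upper bound for every cycle length, is the depth of the bags. *)
Lemma f_property_cycles r (len : 'I_r -> nat) m L : 0 < r -> (forall i, 2 < len i) ->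
  m.*2 + 3 <= L -> (r * L).*2 < 2 ^ m ->
  f_property (@cycles_edge r len) (3 * #|cycles_vertex len| + (3 * (r * L) + r)).
Proof.
move=> r_gt0 hlen mL Lm V G hG hminor; rewrite card_cycles_vertex.
set h := \sum_i len i.
have len_le i : len i <= h by rewrite /h (bigD1 i) //= leq_addr.
have h_gt1 : 1 < h.
  by apply: leq_trans (len_le (Ordinal r_gt0)); apply: ltnW.
have [[C [hC hd]]|[X [x1 x2]]] :=
  family_or_hitting (ends2 hG) len_le mL Lm [set: edge G] [set: 'I_r].
  case: hminor.
  have hs i : exists s, [/\ cycle G s, uniq s, 2 < len i <= size s & supp (@ends _ G) (C i) =i s].
    have [c1 c2 c3] := hC i (in_setT i).
    have [_ [s [s1 s2 s3 s4]]] := circuit_struct (ends2 hG) c1; exists s; split=> //.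
      by apply: sub_cycle s1 => x y; apply: adj_rel.
    by rewrite hlen s3.
  have [s hs'] := fin_all_exists hs.
  apply: (cycles_minor hG (s := s)) => [i|i|i|i j x hi hj]; try by have [] := hs' i.
  apply/eqP; apply: contraT => hij; have := hd i j (in_setT i) (in_setT j) hij.
  have [_ _ _ si] := hs' i; have [_ _ _ sj] := hs' j.
  by move/disjointFr => /(_ x); rewrite si sj hi hj => /(_ isT).
apply: treewidth_leW (treewidth_short_cycles hG h_gt1 _).
  rewrite -[X in X <= _](addnC h); apply: leq_trans (leq_add (leqnn h) x1) _.
  rewrite (eq_bigl xpredT) => [|i]; last by rewrite inE.
  rewrite (eq_bigr (fun i => len i * 2)) => [|i _]; last by rewrite muln2.
  by rewrite -big_distrl /= addnA leq_add2r -/h; clear; lia.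
move=> s s1 s2 s3 s4; have [Z [z1 z2 z3]] := cycle_circuit s1 s2 s3.
rewrite -z2; apply: x2 => //.
by apply/pred0P=> x /=; apply/negP=> /andP[/(subsetP z3)/s4]; rewrite inE => /negPf->.
Qed.

(** The choice is m = 2(t+1) + 8 and L = 2m + 3. With z = 2^(t+1) we have r < z and L < 128z, so 2rL
    < 256z^2 = 2^m. *)
Lemma cycles_parameters t r : r < 2 ^ t.+1 ->
  (r * (4 * t.+1 + 19)).*2 < 2 ^ (2 * t.+1 + 8).
Proof.
move=> hr; apply: leq_trans (_ : (2 ^ t.+1 * (128 * 2 ^ t.+1)).*2 <= _).
  rewrite ltn_double; apply: leq_ltn_trans (_ : 2 ^ t.+1 * (4 * t.+1 + 19) < _).
    by rewrite leq_mul2r ltnW ?orbT.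
  rewrite ltn_pmul2l ?expn_gt0 //; have := ltn_expl t.+1 (ltnSn 1).
  by move: (2 ^ t.+1) => z; clear; lia.
rewrite expnD (mul2n t.+1) -(addnn t.+1) expnD (_ : 2 ^ 8 = 256) //.
by move: (2 ^ t.+1) => z; clear; nia.
Qed.

(** Substituting L turns 3rL + r into r(12t + 70), and r is at most h because every cycle has a
    vertex; the remaining 3h makes 73. *)
Lemma f_property_cycles_log r (len : 'I_r -> nat) : 0 < r -> (forall i, 2 < len i) ->
  let h := #|cycles_vertex len| in let t := trunc_log 2 r in
  exists n, [/\ f_property (@cycles_edge r len) n, n <= h * (12 * t + 73) & 2 ^ t <= r].
Proof.
move=> r_gt0 hlen h t; pose L := 4 * t.+1 + 19.
exists (3 * h + (3 * (r * L) + r)); split; last exact: trunc_logP.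
  apply: (f_property_cycles (m := 2 * t.+1 + 8)) => //; first by rewrite /L; clear; lia.
  exact/cycles_parameters/trunc_log_ltn.
have hh : r <= h.
  rewrite /h card_cycles_vertex -[X in X <= _](card_ord r) -sum1_card.
  by apply: leq_sum=> i _; apply: leq_trans (hlen i).
apply: leq_trans (_ : 3 * h + r * (12 * t + 70) <= _); first by rewrite /L; clear; nia.
apply: leq_trans (_ : 3 * h + h * (12 * t + 70) <= _); last by clear; nia.
by rewrite leq_add2l leq_mul2r hh orbT.
Qed.

(* Passage to real logarithms *)
From Stdlib Require Import Reals Lra.

Lemma INR_addn m n : INR (addn m n) = (INR m + INR n)%R. Proof. exact: plus_INR. Qed.
Lemma INR_muln m n : INR (muln m n) = (INR m * INR n)%R. Proof. exact: mult_INR. Qed.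
Lemma INR_expn m n : INR (expn m n) = (INR m ^ n)%R.
Proof. by elim: n => //= n IH; rewrite expnS INR_muln IH. Qed.
Lemma INR_leq m n : m <= n -> (INR m <= INR n)%R. Proof. by move/leP; apply: le_INR. Qed.

Lemma log2_ge (t : nat) (x : R) : (2 ^ t <= x)%R -> (INR t <= log2 x)%R.
Proof.
move=> h; have l2 : (0 < ln 2)%R by rewrite -ln_1; apply: ln_increasing; lra.
have p2 : (0 < 2 ^ t)%R by apply: pow_lt; lra.
rewrite /log2; apply: (Rmult_le_reg_r (ln 2)) => //.
rewrite /Rdiv Rmult_assoc Rinv_l ?Rmult_1_r; last by lra.
rewrite -ln_pow; last by lra.
by case: (Rle_lt_or_eq_dec _ _ h) => [h'|<-]; [left; apply: ln_increasing | right].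
Qed.

Theorem theorem1p2 :
  exists c : R,
    forall (r l : nat), 0 < r -> 0 < l ->
    forall len : 'I_r -> nat, (forall i, 3 <= len i <= l) ->
    exists n : nat,
      f_property (@cycles_edge r len) n /\
      (INR n <= c * INR #|cycles_vertex len| * log2 (INR r + 1)
                + c * INR r * log2 (INR r) * log2 (INR l))%R.
Proof.
(* 85 = 12 + 73: both t and 1 are at most log(r + 1). *)
exists 85%R => r l r_gt0 l_gt0 len hlen.
have [|n [hn /INR_leq hle /INR_leq htr]] := f_property_cycles_log r_gt0 (len := len).
  by move=> i; case/andP: (hlen i).
exists n; split=> //.
set h := #|cycles_vertex len| in hle *; set t := trunc_log 2 r in hle htr.
rewrite INR_muln INR_addn INR_muln in hle; rewrite INR_expn in htr.
have e12 : INR 12 = 12%R by rewrite INR_IZR_INZ.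
have e73 : INR 73 = 73%R by rewrite INR_IZR_INZ.
rewrite e12 e73 in hle.
have rR := INR_leq r_gt0; have lR := INR_leq l_gt0; rewrite /= in rR lR htr.
have log_ge0 x : (1 <= x)%R -> (0 <= log2 x)%R.
  by move=> hx; apply: (log2_ge (t := 0)); rewrite /=; lra.
have lr0 := log_ge0 _ rR; have ll0 := log_ge0 _ lR.
have l1 : (1 <= log2 (INR r + 1))%R.
  by apply: (log2_ge (t := 1)); rewrite /=; lra.
have lt : (INR t <= log2 (INR r + 1))%R.
  by apply: log2_ge; apply: Rle_trans htr _; lra.
have h0 : (0 <= INR h)%R := pos_INR h.
have h2 : (0 <= 85 * INR r * log2 (INR r) * log2 (INR l))%R.
  by repeat apply: Rmult_le_pos => //; lra.
have h3 : (INR h * (12 * INR t + 73) <= INR h * (85 * log2 (INR r + 1)))%R.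
  by apply: Rmult_le_compat_l => //; lra.
lra.
Qed.
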